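(* Let $F$ be the set consisting of the following 13 partitions: $$(1,1,1),(2,1,1),(2,2,1),(3,2,1),(3,3,1),(5,3,3),(4,4,1,1),(5,4,1,1),(5,4,2,1),(5,5,2,1),(6,5,3,1,1),(6,6,3,1,1),(7,6,4,2,1),$$ and let $$I_1=\{(1),(5,4,2,2),(9,8,6,4,2,2)\},\qquad I_2=\{(1,1),(2,2),(4,3,1)\},$$ $$I_3=\{(1,1),(2,1),(2,2),(3,2),(3,3),(4,3,1),(4,4,1),(5,4,2),(6,5,3,1)\}.$$ For $1\le a\le3$, let $\mathsf{L}_a$ be the set of partitions that do not begin with $\boldsymbol{c}$ for any $\boldsymbol{c}\in I_a$ and do not match $(b_1+k,\dots,b_p+k)$ for any $(b_1,\dots,b_p)\in F$ and any integer $k\ge0$. Then for every integer $n\ge 0$: 1. the number of partitions of $n$ in $\mathsf{L}_1$ equals the number of partitions of $n$ all of whose parts are congruent to $2,3,4,5,11,12,13$ or $14$ modulo $16$; 2. the number of partitions of $n$ in $\mathsf{L}_2$ equals the number of partitions of $n$ all of whose parts are odd; 3. the number of partitions of $n$ in $\mathsf{L}_3$ equals the number of partitions of $n$ all of whose parts are congruent to $1,4,6,7,9,10,12$ or $15$ modulo $16$.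
   Context: A partition $\lambda=(\lambda_1,\dots,\lambda_\ell)$ of a non-negative integer $n$ is a (possibly empty) weakly decreasing sequence of positive integers (parts) with sum $n$. A partition $\lambda=(\lambda_1,\dots,\lambda_\ell)$ begins with $(d_1,\dots,d_r)$ if $\ell\ge r$ and $(\lambda_{\ell-r+1},\dots,\lambda_\ell)=(d_1,\dots,d_r)$ (i.e. the $r$ smallest parts are $d_1,\dots,d_r$). It matches $(d_1,\dots,d_r)$ if $\ell\ge r$ and $(\lambda_{i+1},\dots,\lambda_{i+r})=(d_1,\dots,d_r)$ for some $0\le i\le\ell-r$. *)

(* Defs.v *)
From mathcomp Require Import all_boot.
From mathcomp Require Import boolp.

Set Implicit Arguments.
Unset Strict Implicit.
Unset Printing Implicit Defensive.

(* Partitions are written with their parts in weakly decreasing order, so the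
   smallest parts come last: a partition begins with c when c is a suffix. *)
Definition is_partition (s : seq nat) : bool := sorted geq s && all (ltn 0) s.

Definition is_partition_of (n : nat) (s : seq nat) : bool :=
  is_partition s && (sumn s == n).

Definition begins_with (s c : seq nat) : bool := suffix c s.

Definition matches (s d : seq nat) : bool := infix d s.

Definition shift (k : nat) (b : seq nat) : seq nat := [seq x + k | x <- b].

Definition F : seq (seq nat) :=
  [:: [:: 1; 1; 1]; [:: 2; 1; 1]; [:: 2; 2; 1]; [:: 3; 2; 1]; [:: 3; 3; 1];
      [:: 5; 3; 3]; [:: 4; 4; 1; 1]; [:: 5; 4; 1; 1]; [:: 5; 4; 2; 1];
      [:: 5; 5; 2; 1]; [:: 6; 5; 3; 1; 1]; [:: 6; 6; 3; 1; 1];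
      [:: 7; 6; 4; 2; 1]].

Definition I1 : seq (seq nat) :=
  [:: [:: 1]; [:: 5; 4; 2; 2]; [:: 9; 8; 6; 4; 2; 2]].

Definition I2 : seq (seq nat) := [:: [:: 1; 1]; [:: 2; 2]; [:: 4; 3; 1]].

Definition I3 : seq (seq nat) :=
  [:: [:: 1; 1]; [:: 2; 1]; [:: 2; 2]; [:: 3; 2]; [:: 3; 3]; [:: 4; 3; 1];
      [:: 4; 4; 1]; [:: 5; 4; 2]; [:: 6; 5; 3; 1]].

Definition L (I : seq (seq nat)) (s : seq nat) : Prop :=
  [/\ is_partition s,
      (forall c, c \in I -> ~ begins_with s c)
    & (forall b k, b \in F -> ~ matches s (shift k b))].

(* A partition of n has at most n parts, each at most n, so it is an element of
   the finite type n.-bseq 'I_n.+1 (see partition_bseq). *)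
Definition num_partitions (n : nat) (P : seq nat -> Prop) : nat :=
  #|[set t : n.-bseq 'I_n.+1 |
      `[< is_partition_of n (map val t) /\ P (map val t) >]]|.

Lemma partition_bseq (n : nat) (s : seq nat) :
  is_partition_of n s -> exists! t : n.-bseq 'I_n.+1, map val t = s.
Proof.
case/andP=> /andP[_ pos_s] /eqP sum_s.
have size_s : size s <= n.
  rewrite -sum_s {sum_s}; elim: s pos_s => //= x s IHs /andP[x_gt0 /IHs].
  by rewrite -add1n => /(leq_add x_gt0).
have le_s : all (fun x => x < n.+1) s.
  apply/allP=> x xs; rewrite ltnS -sum_s {pos_s sum_s size_s}.
  elim: s xs => //= y s IHs; rewrite inE => /predU1P[->|/IHs le_xs].
    exact: leq_addr.
  exact: leq_trans le_xs (leq_addl _ _).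
have map_s : map val (map (@inord n) s) = s.
  rewrite -map_comp -[RHS]map_id; apply/eq_in_map=> x /(allP le_s) lt_x.
  exact: inordK.
have size_t : size (map (@inord n) s) <= n by rewrite size_map.
exists (Bseq size_t); split=> // t def_t; apply/val_inj.
by apply: (inj_map val_inj); rewrite def_t.
Qed.

Definition parts_mod16 (R : seq nat) (s : seq nat) : Prop :=
  forall x, x \in s -> x %% 16 \in R.

(* Main.v *)
Require Import Defs.
From HB Require Import structures.
From mathcomp Require Import all_boot all_order all_algebra.
From mathcomp Require Import boolp zify ring.

(** Write c_n = 1/((1 - q) ... (1 - q^n)) and put
<<
  W a b = sum over i, j of q^(4i^2 + 3ij + j^2 + ai + bj) c_i c_j.
>>
    The proof computes the generating function of each of the three classes
    L_a in three stages.

    1. From partitions to W.  Read a partition from its smallest part upwards.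
    All patterns are translates of the elements of F, and what the parts read
    so far forbid to the later ones can be summarized by one of nine contexts
    (ctx): two contexts that forbid the same continuations are identified
    (avoids_step).  Every part occurs at most twice, so the generating
    functions of the nine contexts satisfy a linear q-difference system
    (gf_ctx_rec).  The series W_ctx satisfy the same system, using only the
    relations W_recl and W_recr, which remove one factor of c_i or c_j; since
    a solution that is 1 modulo q^u at position u is unique (ctx_rec_unique),
    the two families agree (gf_ctxE).  The sets I_a and the restriction of the translates of
    (5,3,3) to parts at least 3 only matter for the first few parts; treating
    these by hand yields
<<
  L_1 : W 0 0 - q W 4 2,   L_2 : W 1 0 + q^3 W 7 3,   L_3 : W 3 1 + q W 5 2.
>>
    2. From double to single sums.  W (2b + d) b equals a second double sum
    V d b with a q-binomial coefficient in the summand (W_V), because both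
    satisfy the same recurrence in d.  In the three combinations above, the
    inner sum of V telescopes, and what is left are the three characters of
    the Ising model (W_vacuum, W_odd0, W_odd1):
<<
  sum q^(2n^2) c_2n,  sum q^(2n^2 + n) c_(2n+1),  sum q^(2n^2 + 2n) c_(2n+1).
>>
    3. From sums to products.  The middle series is obtained by pairing
    consecutive terms of Euler's expansion of the product of all 1 + q^k.
    The two others are, after q is replaced by q^2, the even and the odd part
    of Euler's expansion of the product of all 1 + q^(2k+1).  Multiplying that
    product by the product of all 1 - q^(4k) gives a theta series by the
    Jacobi triple product, and its even and odd parts are again theta series,
    to which the triple product applies a second time (ising_theta).
    Cancelling common factors leaves the products over residue classes
    modulo 16 (ising0_prod, ising1_prod), whose inverses are the generating
    functions of the partitions with parts in these classes
    (gf_all_prodm). *)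

Set Implicit Arguments.
Unset Strict Implicit.
Unset Printing Implicit Defensive.

Import GRing.Theory.
Local Open Scope ring_scope.

(** * The ring of formal power series over the integers *)

Record fps := Fps { coef :> nat -> int }.

Lemma fpsP (f g : fps) : (forall n, f n = g n) -> f = g.
Proof. by case: f g => [f] [g] fg; congr Fps; apply/funext. Qed.

HB.instance Definition _ := gen_eqMixin fps.
HB.instance Definition _ := gen_choiceMixin fps.

Definition fps0 := Fps (fun=> 0).
Definition fps_add (f g : fps) := Fps (fun n => f n + g n).
Definition fps_opp (f : fps) := Fps (fun n => - f n).

Fact fps_addA : associative fps_add.
Proof. by move=> f g h; apply: fpsP => n; apply: addrA. Qed.
Fact fps_addC : commutative fps_add.
Proof. by move=> f g; apply: fpsP => n; apply: addrC. Qed.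
Fact fps_add0 : left_id fps0 fps_add.
Proof. by move=> f; apply: fpsP => n; apply: add0r. Qed.
Fact fps_addN : left_inverse fps0 fps_opp fps_add.
Proof. by move=> f; apply: fpsP => n; apply: addNr. Qed.

HB.instance Definition _ :=
  GRing.isZmodule.Build fps fps_addA fps_addC fps_add0 fps_addN.

Definition fps1 := Fps (fun n => (n == 0)%:R).
Definition fps_mul (f g : fps) := Fps (fun n => \sum_(i < n.+1) f i * g (n - i)%N).

Definition fps_trunc N (f : fps) : {poly int} := \poly_(i < N) f i.

(** A coefficient of a product depends only on truncations of the factors, so
    associativity and commutativity can be borrowed from polynomials. *)
Lemma fps_mul_trunc N f g n :
  (n < N)%N -> fps_mul f g n = (fps_trunc N f * fps_trunc N g)`_n.
Proof.
move=> ltnN; rewrite coefM; apply: eq_bigr => i _.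
by have := ltn_ord i; rewrite !coef_poly => lt_i; rewrite !ifT //; lia.
Qed.

Fact fps_mulA : associative fps_mul.
Proof.
move=> f g h; apply: fpsP => n; pose t := fps_trunc n.+1.
have -> : fps_mul f (fps_mul g h) n = (t f * (t g * t h))`_n.
  rewrite coefM; apply: eq_bigr => i _.
  by have := ltn_ord i; rewrite coef_poly => lt_i; rewrite ifT // -fps_mul_trunc //; lia.
rewrite mulrA coefM; apply: eq_bigr => i _.
by have := ltn_ord i; rewrite coef_poly => lt_i; rewrite -fps_mul_trunc // ifT //; lia.
Qed.
Fact fps_mulC : commutative fps_mul.
Proof.
by move=> f g; apply: fpsP => n; rewrite !(fps_mul_trunc _ _ (ltnSn n)) mulrC.
Qed.
Fact fps_mul1 : left_id fps1 fps_mul.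
Proof.
move=> f; apply: fpsP => n /=; rewrite big_ord_recl /= subn0 mul1r.
by rewrite big1 ?addr0 // => i _; rewrite mul0r.
Qed.
Fact fps_mulDl : left_distributive fps_mul fps_add.
Proof.
move=> f g h; apply: fpsP => n /=; rewrite -big_split /=.
by apply: eq_bigr => i _; rewrite mulrDl.
Qed.
Fact fps1_neq0 : fps1 != fps0.
Proof. by apply/eqP => /(congr1 (fun f : fps => f 0)). Qed.

HB.instance Definition _ := GRing.Zmodule_isComNzRing.Build fps
  fps_mulA fps_mulC fps_mul1 fps_mulDl fps1_neq0.

Lemma coefD (f g : fps) k : (f + g) k = f k + g k. Proof. by []. Qed.
Lemma coefN (f : fps) k : (- f) k = - f k. Proof. by []. Qed.
Lemma coefB (f g : fps) k : (f - g) k = f k - g k. Proof. by []. Qed.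
Lemma coef0 k : (0 : fps) k = 0. Proof. by []. Qed.
Lemma coef1 k : (1 : fps) k = (k == 0)%:R. Proof. by []. Qed.
Lemma coefM (f g : fps) k : (f * g) k = \sum_(i < k.+1) f i * g (k - i)%N.
Proof. by []. Qed.
Lemma coef_sum I (r : seq I) (P : pred I) (F : I -> fps) k :
  (\sum_(i <- r | P i) F i) k = \sum_(i <- r | P i) F i k.
Proof. by apply: (big_morph (fun f : fps => f k)) => // f g; rewrite coefD. Qed.

Definition q : fps := Fps (fun k => (k == 1)%:R).

Lemma coefqM n (f : fps) k :
  (q ^+ n * f) k = if (k < n)%N then 0 else f (k - n)%N.
Proof.
elim: n k => [|n IHn] k; first by rewrite mul1r subn0.
rewrite exprS -mulrA coefM; case: k => [|k].
  by rewrite big_ord1 mul0r.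
rewrite 2!big_ord_recl big1 ?addr0 => [|i _]; last by rewrite mul0r.
by rewrite mul0r add0r mul1r lift0 !subSS subn0 IHn.
Qed.

(** * The q-adic topology and infinite sums *)

(** The series divisible by [q ^+ n]: congruence modulo [q ^+ n] is written
    [O n (f - g)] throughout. *)
Definition O n (f : fps) := forall k, (k < n)%N -> f k = 0.

Lemma O0 f : O 0 f. Proof. by []. Qed.
Lemma OW m n f : (m <= n)%N -> O n f -> O m f.
Proof. by move=> le_mn Of k lt_km; apply: Of; lia. Qed.
Lemma OD n f g : O n f -> O n g -> O n (f + g).
Proof. by move=> Of Og k lt_kn; rewrite coefD Of ?Og. Qed.
Lemma ON n f : O n f -> O n (- f).
Proof. by move=> Of k lt_kn; rewrite coefN Of ?oppr0. Qed.
Lemma OB n f g : O n f -> O n g -> O n (f - g).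
Proof. by move=> Of Og; apply: OD => //; apply: ON. Qed.
Lemma OMl n f g : O n f -> O n (g * f).
Proof.
move=> Of k lt_kn; rewrite coefM big1 // => i _.
by have := ltn_ord i => lt_i; rewrite Of ?mulr0 //; lia.
Qed.
Lemma OMr n f g : O n f -> O n (f * g).
Proof. by rewrite mulrC; apply: OMl. Qed.
Lemma Oq n m f : (m <= n)%N -> O m (q ^+ n * f).
Proof. by move=> le_mn k lt_km; rewrite coefqM ifT //; lia. Qed.
Lemma Oq1 n m : (m <= n)%N -> O m (q ^+ n).
Proof. by rewrite -[q ^+ n]mulr1; apply: Oq. Qed.
Lemma OqM n m f : O m f -> O (n + m) (q ^+ n * f).
Proof. by move=> Of k lt_k; rewrite coefqM; case: ltnP => // ?; apply: Of; lia. Qed.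
Lemma O_sum I (r : seq I) (P : pred I) (F : I -> fps) n :
  (forall i, P i -> O n (F i)) -> O n (\sum_(i <- r | P i) F i).
Proof. by move=> OF k lt_kn; rewrite coef_sum big1 // => i /OF->. Qed.

Lemma O_eq f g : (forall n, O n (f - g)) -> f = g.
Proof.
by move=> Ofg; apply: fpsP => k; apply/subr0_eq; apply: (Ofg k.+1 k (ltnSn k)).
Qed.

(** A sum whose n-th term is divisible by q^n: under [summ], the terms of index
    above k do not reach degree k, so cutting the sum at k loses nothing. *)
Definition lsum (F : nat -> fps) := Fps (fun k => \sum_(n < k.+1) F n k).
Definition summ (F : nat -> fps) := forall n, O n (F n).

Lemma lsumE F N k : summ F -> (k < N)%N -> lsum F k = \sum_(n < N) F n k.
Proof.
move=> sF ltkN; rewrite /= -!(big_mkord xpredT (fun n => F n k)).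
rewrite [RHS](@big_cat_nat _ _ _ k.+1) //= [X in _ + X]big_nat_cond [X in _ + X]big1 ?addr0 //.
by move=> i /andP[/andP[lt_ki _] _]; apply: sF.
Qed.

Lemma eq_lsum F G : F =1 G -> lsum F = lsum G.
Proof. by move=> FG; apply: fpsP => k; apply: eq_bigr => i _; rewrite FG. Qed.

Lemma lsumD F G : lsum (fun n => F n + G n) = lsum F + lsum G.
Proof. by apply: fpsP => k; rewrite coefD -big_split. Qed.
Lemma lsumN F : lsum (fun n => - F n) = - lsum F.
Proof. by apply: fpsP => k; rewrite coefN -sumrN. Qed.
Lemma lsumB F G : lsum (fun n => F n - G n) = lsum F - lsum G.
Proof. by rewrite lsumD lsumN. Qed.

Lemma lsumM g F : summ F -> lsum (fun n => g * F n) = g * lsum F.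
Proof.
move=> sF; apply: fpsP => k; rewrite coefM.
rewrite [LHS]exchange_big; apply: eq_bigr => i _.
by rewrite -mulr_sumr -(lsumE sF) // ltnS leq_subr.
Qed.

Lemma lsum_recl F : summ F -> lsum F = F 0 + lsum (fun n => F n.+1).
Proof.
move=> sF; apply: fpsP => k.
rewrite (lsumE sF (ltnW (ltnSn k.+1))) coefD big_ord_recl; congr (_ + _).
Qed.

Lemma O_lsum m F : (forall n, O m (F n)) -> O m (lsum F).
Proof. by move=> OF k lt_km; rewrite /= big1 // => i _; apply: OF. Qed.

Lemma lsum0 F : (forall n, F n = 0) -> lsum F = 0.
Proof. by move=> F0; apply: fpsP => k; rewrite /= big1 // => i _; rewrite F0. Qed.

Lemma exchange_lsum (F : nat -> nat -> fps) :
    (forall m, summ (F m)) -> (forall n, summ (F^~ n)) ->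
  lsum (fun m => lsum (F m)) = lsum (fun n => lsum (F^~ n)).
Proof. by move=> s1 s2; apply: fpsP => k /=; apply: exchange_big. Qed.

Lemma lsum_telescope (R : nat -> fps) :
  summ R -> lsum (fun n => R n.+1 - R n) = - R 0.
Proof.
move=> sR; rewrite lsumB [X in _ - X]lsum_recl // opprD addrCA subrr addr0 //.
Qed.

(** Exponents that are linear expressions with products of variables are split
    into products of powers, on which [ring] treats the factors as atoms. *)
Ltac qring := rewrite ?(mulSn, mulnS, mul0n, muln0) ?(exprD, exprS, expr0); ring.

(** * Double sums *)

Definition lsum2 (F : nat -> nat -> fps) := lsum (fun i => lsum (F i)).
Definition summ2 (F : nat -> nat -> fps) := forall i j, O i (F i j) /\ O j (F i j).

Section Lsum2.
Variables (F G : nat -> nat -> fps).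
Hypotheses (sF : summ2 F).

Lemma summ2_row i : summ (F i). Proof. by move=> j; case: (sF i j). Qed.
Lemma summ2_lsum : summ (fun i => lsum (F i)).
Proof. by move=> i; apply: O_lsum => j; case: (sF i j). Qed.

Lemma lsum2B : lsum2 (fun i j => F i j - G i j) = lsum2 F - lsum2 G.
Proof. by rewrite /lsum2 -lsumB; apply: eq_lsum => i; rewrite lsumB. Qed.
Lemma lsum2D : lsum2 (fun i j => F i j + G i j) = lsum2 F + lsum2 G.
Proof. by rewrite /lsum2 -lsumD; apply: eq_lsum => i; rewrite lsumD. Qed.
Lemma lsum2M g : lsum2 (fun i j => g * F i j) = g * lsum2 F.
Proof.
rewrite /lsum2 -lsumM; last exact: summ2_lsum.
by apply: eq_lsum => i; rewrite lsumM //; apply: summ2_row.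
Qed.
Lemma lsum2C : lsum2 F = lsum2 (fun i j => F j i).
Proof.
by apply: exchange_lsum => [i|j]; [apply: summ2_row | move=> i; case: (sF i j)].
Qed.
Lemma lsum2_recl : lsum2 F = lsum (F 0) + lsum2 (fun i j => F i.+1 j).
Proof. by rewrite /lsum2 lsum_recl //; apply: summ2_lsum. Qed.
End Lsum2.

Lemma eq_lsum2 F G : F =2 G -> lsum2 F = lsum2 G.
Proof. by move=> FG; apply: eq_lsum => i; apply: eq_lsum => j; apply: FG. Qed.

(** Reindexing in one variable when its boundary terms vanish; this is how the
    factor 1 - q^i, which kills the term i = 0, produces recurrences. *)
Lemma lsum2_shiftl F G :
    summ2 F -> (forall j, F 0 j = 0) -> (forall i j, F i.+1 j = G i j) ->
  lsum2 F = lsum2 G.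
Proof.
move=> sF F0 FS; rewrite (lsum2_recl sF) lsum0 // add0r.
by apply: eq_lsum2.
Qed.

Lemma summ2_tr F : summ2 F -> summ2 (fun i j => F j i).
Proof. by move=> sF i j; case: (sF j i). Qed.

Lemma lsum2_shiftr F G :
    summ2 F -> summ2 G -> (forall i, F i 0 = 0) -> (forall i j, F i j.+1 = G i j) ->
  lsum2 F = lsum2 G.
Proof.
move=> sF sG F0 FS; rewrite (lsum2C sF) (lsum2C sG).
by apply: lsum2_shiftl => //; apply: summ2_tr.
Qed.

Lemma summ2q (e : nat -> nat -> nat) (F : nat -> nat -> fps) :
  (forall i j, i <= e i j /\ j <= e i j)%N -> summ2 (fun i j => q ^+ e i j * F i j).
Proof. by move=> le_e i j; case: (le_e i j); split; apply: Oq. Qed.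

(** * q-Pochhammer symbols and Gaussian binomials *)

(** The geometric series 1/(1 - q^k). *)
Definition geom k : fps := Fps (fun n => (k %| n)%N%:R).

Lemma geomK k : (0 < k)%N -> (1 - q ^+ k) * geom k = 1.
Proof.
move=> k_gt0; apply: fpsP => n; rewrite mulrBl mul1r coefB coefqM coef1 /=.
case: ltnP => [lt_nk | le_kn].
  rewrite subr0; case: n lt_nk => [|n] lt_nk; first by rewrite dvdn0.
  by rewrite gtnNdvd.
have -> : (k %| n)%N = (k %| n - k)%N by rewrite -{1}(subnK le_kn) dvdn_addl.
rewrite subrr.
by case: n le_kn => //; rewrite leqn0 => /eqP k0; rewrite k0 in k_gt0.
Qed.

(** 1/(x;x)_n for x = q^m. *)
Definition ipoch m n := \prod_(i < n) geom (m * i.+1).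

Lemma ipoch0 m : ipoch m 0 = 1. Proof. exact: big_ord0. Qed.
Lemma ipochS m n :
  (0 < m)%N -> (1 - q ^+ (m * n.+1)) * ipoch m n.+1 = ipoch m n.
Proof. by move=> m0; rewrite /ipoch big_ord_recr /= mulrCA geomK ?mulr1 // muln_gt0 m0. Qed.

Local Notation c := (ipoch 1).
Lemma cS n : (1 - q ^+ n.+1) * c n.+1 = c n.
Proof. by have := @ipochS 1 n isT; rewrite mul1n. Qed.

(** (q^(m+1); q)_r. *)
Definition poch m r := \prod_(i < r) (1 - q ^+ (m + i).+1).

Lemma poch0 m : poch m 0 = 1. Proof. exact: big_ord0. Qed.
Lemma pochSr m r : poch m r.+1 = poch m r * (1 - q ^+ (m + r).+1).
Proof. by rewrite /poch big_ord_recr. Qed.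
Lemma pochSl m r : poch m r.+1 = (1 - q ^+ m.+1) * poch m.+1 r.
Proof.
rewrite /poch big_ord_recl addn0; congr (_ * _).
by apply: eq_bigr => i _; rewrite /= addnS.
Qed.
Lemma pochD n m r : poch n (m + r) = poch n m * poch (n + m) r.
Proof.
elim: r => [|r IHr]; first by rewrite addn0 poch0 mulr1.
by rewrite addnS !pochSr IHr addnA mulrA.
Qed.
Lemma poch_c n : poch 0 n * c n = 1.
Proof.
elim: n => [|n IHn]; first by rewrite poch0 ipoch0 mulr1.
by rewrite pochSr add0n -mulrA cS.
Qed.
Lemma O_poch m r : O m (poch m r - 1).
Proof.
elim: r => [|r IHr]; first by rewrite poch0 subrr.
rewrite pochSr mulrBr mulr1 addrAC; apply: OB => //.
by apply: OMl; apply: Oq1; lia.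
Qed.

(** The q-binomial coefficient of m + r over r. *)
Definition qbin m r := poch m r * c r.

Lemma qbin0 m : qbin m 0 = 1. Proof. by rewrite /qbin poch0 ipoch0 mulr1. Qed.
Lemma qbin_sym m r : qbin m r = poch r m * c m.
Proof.
rewrite /qbin; transitivity (poch 0 (m + r) * (c m * c r)).
  by rewrite pochD add0n -[LHS]mul1r -(poch_c m); ring.
by rewrite addnC pochD add0n -[RHS]mul1r -(poch_c r); ring.
Qed.
Lemma qbin_pascal m r : qbin m.+1 r.+1 = qbin m r.+1 + q ^+ m.+1 * qbin m.+1 r.
Proof.
rewrite /qbin (pochSl m) (pochSr m.+1) -(cS r).
have -> : q ^+ (m.+1 + r).+1 = q ^+ m.+1 * q ^+ r.+1 by rewrite -exprD addnS.
ring.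
Qed.
Lemma qbin_pascal2 m r : qbin m.+1 r.+1 = q ^+ r.+1 * qbin m r.+1 + qbin m.+1 r.
Proof.
rewrite /qbin (pochSl m) (pochSr m.+1) -(cS r).
have -> : q ^+ (m.+1 + r).+1 = q ^+ m.+1 * q ^+ r.+1 by rewrite -exprD addnS.
ring.
Qed.

(** * The double sums W and V *)

Definition eW (a b i j : nat) := (4 * i * i + 3 * i * j + j * j + a * i + b * j)%N.
Definition W a b := lsum2 (fun i j => q ^+ eW a b i j * (c i * c j)).

Lemma leq_sq n : (n <= n * n)%N. Proof. by case: n => // n; rewrite leq_pmulr. Qed.

Lemma sW a b : summ2 (fun i j => q ^+ eW a b i j * (c i * c j)).
Proof.
apply: summ2q => i j; rewrite /eW.
by have := leq_sq i; have := leq_sq j; split; lia.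
Qed.

Lemma summ2B F H : summ2 F -> summ2 H -> summ2 (fun i j => F i j - H i j).
Proof.
by move=> sF sG i j; case: (sF i j) (sG i j) => ? ? [? ?]; split; apply: OB.
Qed.
Lemma summ2M g F : summ2 F -> summ2 (fun i j => g * F i j).
Proof. by move=> sF i j; case: (sF i j); split; apply: OMl. Qed.

(** In W a b - W (a + 1) b every term carries 1 - q^i, which turns c_i into
    c_(i-1); then i is shifted by one. *)
Lemma W_recl a b : W a b = W a.+1 b + q ^+ (a + 4) * W (a + 8) (b + 3).
Proof.
apply/eqP; rewrite -subr_eq0 opprD addrA subr_eq0; apply/eqP.
rewrite -lsum2M ?/W -?lsum2B; try exact: sW.
apply: lsum2_shiftl => [|j|i j].
- by apply: summ2B; apply: sW.
- by rewrite (_ : eW a.+1 b 0 j = eW a b 0 j) ?subrr // /eW; lia.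
rewrite -(cS i).
have -> : eW a.+1 b i.+1 j = (i.+1 + eW a b i.+1 j)%N by rewrite /eW; lia.
have -> : eW a b i.+1 j = (a + 4 + eW (a + 8) (b + 3) i j)%N by rewrite /eW; lia.
rewrite !exprD; ring.
Qed.

Lemma W_recr a b : W a b = W a b.+1 + q ^+ b.+1 * W (a + 3) (b + 2).
Proof.
apply/eqP; rewrite -subr_eq0 opprD addrA subr_eq0; apply/eqP.
rewrite -lsum2M ?/W -?lsum2B; try exact: sW.
apply: lsum2_shiftr => [||i|i j].
- by apply: summ2B; apply: sW.
- by apply: summ2M; apply: sW.
- by rewrite (_ : eW a b.+1 i 0 = eW a b i 0) ?subrr // /eW; lia.
rewrite -(cS j).
have -> : eW a b.+1 i j.+1 = (j.+1 + eW a b i j.+1)%N by rewrite /eW; lia.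
have -> : eW a b i j.+1 = (b.+1 + eW (a + 3) (b + 2) i j)%N by rewrite /eW; lia.
rewrite !exprD; ring.
Qed.

(** The exponent of W is (2i + j)^2 - ij up to linear terms.  Expanding q^(-ij) by
    the q-Vandermonde formula and summing over the pairs with a given value of
    2i + j turns W (2b + d) b into V d b; the proof of [W_V] verifies this
    through the recurrence in d that both sums satisfy. *)
Definition eV (d b n r : nat) := (2 * n * n + n * r + r * r + (d + b) * n + b * r)%N.
Definition V d b := lsum2 (fun n r => q ^+ eV d b n r * (c n * qbin (2 * n + d) r)).
Lemma sV d b : summ2 (fun n r => q ^+ eV d b n r * (c n * qbin (2 * n + d) r)).
Proof.
apply: summ2q => i j; rewrite /eV.
by have := leq_sq i; have := leq_sq j; split; lia.
Qed.

(** The difference V d b - V (d + 1) b is split in two: X collects the factor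
    1 - q^n and Y the defect of the q-Pascal rule.  Shifting n in X gives X',
    and the other q-Pascal rule applied to X' - Y gives the last term. *)
Lemma V_rec d b :
  V d b = V d.+1 b + q ^+ (4 + 2 * b + d) * V d.+2 (b + 3).
Proof.
pose X n r : fps := q ^+ eV d b n r * ((1 - q ^+ n) * c n * qbin (2 * n + d) r).
pose X' n r : fps := q ^+ (eV d b n r + 4 * n + 2 + r + b + d)
  * (c n * qbin (2 * n + d).+2 r).
pose Y n r : fps := q ^+ (eV d b n r + 4 * n + 2 * r + 2 + b + d)
  * (c n * qbin (2 * n + d).+1 r).
have le_e i j : (i <= eV d b i j /\ j <= eV d b i j)%N.
  rewrite /eV; have := leq_sq i; have := leq_sq j; split; lia.
have sX : summ2 X by apply: summ2q.
have sX' : summ2 X'.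
  by apply: summ2q => i j; case: (le_e i j); split; lia.
have sY : summ2 Y.
  by apply: summ2q => i j; case: (le_e i j); split; lia.
have XX' : lsum2 X = lsum2 X'.
  apply: lsum2_shiftl => // [r|n r]; first by rewrite /X subrr !mul0r mulr0.
  rewrite /X cS /X' (_ : (2 * n.+1 + d = (2 * n + d).+2)%N); last by lia.
  by congr (q ^+ _ * _); rewrite /eV; lia.
have VXY : V d b - V d.+1 b = lsum2 X - lsum2 Y.
  apply/eqP; rewrite subr_eq addrAC eq_sym subr_eq; apply/eqP.
  rewrite -lsum2D ?/V.
  pose Z n r : fps := X n r + q ^+ eV d.+1 b n r * (c n * qbin (2 * n + d.+1) r)
    - q ^+ eV d b n r * (c n * qbin (2 * n + d) r).
  have -> : lsum2 Y = lsum2 Z.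
    symmetry; apply: lsum2_shiftr => // [|n|n r].
    - apply: summ2B; last exact: sV.
      move=> i j; case: (sX i j) (sV d.+1 b i j) => ? ? [? ?].
      by split; apply: OD.
    - rewrite /Z /X !qbin0 (_ : eV d.+1 b n 0 = (n + eV d b n 0)%N).
        by rewrite exprD; ring.
      by rewrite /eV; lia.
    rewrite /Z /X (_ : eV d.+1 b n r.+1 = (n + eV d b n r.+1)%N).
      rewrite addnS qbin_pascal /Y.
      rewrite (_ : (eV d b n r + 4 * n + 2 * r + 2 + b + d)%N =
        (eV d b n r.+1 + n + (2 * n + d).+1)%N); last by rewrite /eV; lia.
      by rewrite !exprD; ring.
    by rewrite /eV; lia.
  by rewrite -lsum2D; apply: eq_lsum2 => n r; rewrite /Z; ring.
apply/eqP; rewrite addrC -subr_eq; apply/eqP; rewrite VXY XX' -lsum2B.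
rewrite -lsum2M; last exact: sV.
apply: lsum2_shiftr => [|||n r].
- exact: summ2B.
- by apply: summ2M; apply: sV.
- move=> n; rewrite /X' /Y !qbin0.
  rewrite (_ : (eV d b n 0 + 4 * n + 2 * 0 + 2 + b + d = eV d b n 0 + 4 * n + 2 + 0 + b + d)%N) ?subrr //; lia.
rewrite /X' /Y qbin_pascal2.
rewrite (_ : (eV d b n r.+1 + 4 * n + 2 * r.+1 + 2 + b + d)%N =
 (r.+1 + (eV d b n r.+1 + 4 * n + 2 + r.+1 + b + d))%N); last by lia.
rewrite (_ : (eV d b n r.+1 + 4 * n + 2 + r.+1 + b + d)%N =
  (4 + 2 * b + d + eV d.+2 (b + 3) n r)%N); last by rewrite /eV; lia.
rewrite (_ : (2 * n + d.+2 = (2 * n + d).+2)%N); last by lia.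
by set e := eV _ _ _ _; rewrite !exprD; ring.
Qed.

(** The common limit for large d: only the terms with i = 0, respectively
    n = 0, survive, and the q-binomial tends to c_r. *)
Lemma WV_large d b : O d (W (2 * b + d) b - V d b).
Proof.
rewrite /W /V (lsum2_recl (sW _ _)) (lsum2_recl (sV _ _)) opprD addrACA.
apply: OD.
  rewrite -lsumB; apply: O_lsum => r.
  rewrite (_ : eV d b 0 r = eW (2 * b + d) b 0 r); last by rewrite /eV /eW; lia.
  rewrite -mulrBr; apply: OMl; rewrite ipoch0 !mul1r /qbin muln0 add0n.
  rewrite -[X in X - _]mul1r -mulrBl -opprB mulNr; apply: ON; apply: OMr.
  exact: O_poch.
by apply: OB; apply: O_lsum => n; apply: O_lsum => r; apply: Oq; rewrite /eV /eW; lia.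
Qed.

(** The recurrence expresses W - V at d through W - V at d + 1 and a multiple of
    q at d + 2; going down to d = infinity improves the order of divisibility
    by one. *)
Lemma W_V d b : W (2 * b + d) b = V d b.
Proof.
apply: O_eq => k; elim: k => [|k IHk] in d b *; first exact: O0.
have step c0 : O k.+1 ((W (2 * b + c0) b - V c0 b) - (W (2 * b + c0.+1) b - V c0.+1 b)).
  rewrite (_ : (2 * b + c0.+1 = (2 * b + c0).+1)%N); last by lia.
  rewrite W_recl V_rec.
  rewrite (_ : (2 * b + c0 + 4 = 4 + 2 * b + c0)%N); last by lia.
  set u := W _.+1 _; set v := V _.+1 _; set e := q ^+ _.
  rewrite (_ : _ - _ - _ = e * (W (2 * b + c0 + 8) (b + 3) - V c0.+2 (b + 3))); last by ring.
  apply: (@OW _ (4 + 2 * b + c0 + k)); first by lia.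
  apply: OqM; have := IHk c0.+2 (b + 3)%N.
  by rewrite (_ : (2 * (b + 3) + c0.+2 = 2 * b + c0 + 8)%N); last by lia.
have steps n : O k.+1 ((W (2 * b + d) b - V d b) - (W (2 * b + (d + n)) b - V (d + n) b)).
  elim: n => [|n IHn]; first by rewrite addn0 subrr.
  rewrite (_ : (d + n.+1 = (d + n).+1)%N); last by lia.
  by have := OD IHn (step (d + n)%N); rewrite addrA subrK.
have large : O k.+1 (W (2 * b + (d + k.+1)) b - V (d + k.+1) b).
  by apply: OW (@WV_large _ b); lia.
by have := OD (steps k.+1) large; rewrite subrK.
Qed.

(** * Evaluation of three combinations of the W *)

Lemma poch_shift r k : (1 - q ^+ r.+1) * poch r.+1 k = poch r k * (1 - q ^+ (r + k).+1).
Proof. by rewrite -pochSl -pochSr. Qed.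

Lemma lsum_telescope_eq (F R : nat -> fps) :
  summ R -> (forall n, F n = R n.+1 - R n) -> lsum F = - R 0.
Proof. by move=> sR FR; rewrite -lsum_telescope //; apply: eq_lsum. Qed.

(** The summands of the inner sums that occur in the combinations of [W_vacuum],
    [W_odd1] and [W_odd0], cleared of the factor c_(2n), respectively
    c_(2n+1).  All three sums equal (q)_n. *)
Definition tE n r : fps :=
  q ^+ (r * r + n * r) * ((1 - q ^+ (2 * n + 2 * r).+1) * poch r (2 * n)).
Definition tO n r : fps :=
  q ^+ (r * r + n.+1 * r) * ((1 + q ^+ (n + r).+1) * poch r (2 * n).+1).
Definition tO' n r : fps :=
  q ^+ (r * r + n * r) * ((1 + q ^+ (3 * n + 3 * r + 3)) * poch r (2 * n).+1).

Lemma summq (e : nat -> nat) F : (forall n, n <= e n)%N -> summ (fun n => q ^+ e n * F n).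
Proof. by move=> le_e n; apply: Oq. Qed.

Lemma stE n : summ (tE n).
Proof. by apply: summq => r; have := leq_sq r; lia. Qed.
Lemma stO n : summ (tO n).
Proof. by apply: summq => r; have := leq_sq r; lia. Qed.
Lemma stO' n : summ (tO' n).
Proof. by apply: summq => r; have := leq_sq r; lia. Qed.

(** A creative telescoping certificate: the recurrence in n that (q)_n satisfies
    holds for the summand up to a difference in r. *)
Lemma tE_step n r :
  let s r := q ^+ (r * r + n * r) * ((1 - q ^+ r) * poch r (2 * n)
    * (1 - q ^+ n.+1 - q ^+ (n + r).+1 + q ^+ (3 * n + 2 * r + 2))) in
  tE n.+1 r - (1 - q ^+ n.+1) * tE n r = s r.+1 - s r.
Proof.
move=> s; rewrite /s /tE.
have -> : poch r (2 * n.+1) = poch r (2 * n) * (1 - q ^+ (r + 2 * n).+1) * (1 - q ^+ (r + 2 * n).+2).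
  by rewrite (_ : (2 * n.+1 = (2 * n).+2)%N) ?pochSr ?addnS //; lia.
rewrite poch_shift; set P := poch r _.
by qring.
Qed.

Lemma tO_step n r :
  let s r := q ^+ (r * r + n.+1 * r) * ((1 - q ^+ r) * poch r (2 * n).+1
    * (1 - q ^+ n.+1 - q ^+ (2 * n + r + 2))) in
  tO n.+1 r - (1 - q ^+ n.+1) * tO n r = s r.+1 - s r.
Proof.
move=> s; rewrite /s /tO.
have -> : poch r (2 * n.+1).+1
    = poch r (2 * n).+1 * (1 - q ^+ (r + 2 * n).+2) * (1 - q ^+ (r + 2 * n).+3).
  by rewrite (_ : (2 * n.+1 = (2 * n).+2)%N) ?pochSr ?addnS //; lia.
rewrite [(1 - q ^+ r.+1) * _]poch_shift; set P := poch r _.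
by qring.
Qed.

(** The third sum is reduced to the second, from which it differs by a
    telescoping sum. *)
Lemma tO'_tO n r :
  let s r := - (q ^+ (r * r + n * r) * ((1 - q ^+ r) * poch r (2 * n).+1)) in
  tO' n r - tO n r = s r.+1 - s r.
Proof.
move=> s; rewrite /s /tO /tO' poch_shift; set P := poch r _.
by qring.
Qed.

Lemma sum_tE n : lsum (tE n) = poch 0 n.
Proof.
elim: n => [|n IHn].
  pose R r := - q ^+ (r * r).
  rewrite (@lsum_telescope_eq _ R) ?poch0 => [|r|r].
  - by rewrite /R opprK.
  - by rewrite /R; apply/ON/Oq1; apply: leq_sq.
  by rewrite /tE /R poch0; qring.
apply/eqP; rewrite pochSr mulrC -subr_eq0 -IHn -lsumM; last exact: stE.
rewrite -lsumB (lsum_telescope_eq _ (tE_step n)) => [|r].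
  by rewrite [q ^+ 0]expr0 subrr !mul0r mulr0 oppr0.
by apply: Oq; have := leq_sq r; lia.
Qed.

Lemma sum_tO n : lsum (tO n) = poch 0 n.
Proof.
elim: n => [|n IHn].
  pose R r := - q ^+ (r * r + r).
  rewrite (@lsum_telescope_eq _ R) ?poch0 => [|r|r].
  - by rewrite /R opprK.
  - by rewrite /R; apply/ON/Oq1; lia.
  by rewrite /tO /R muln0 pochSr poch0; qring.
apply/eqP; rewrite pochSr mulrC -subr_eq0 -IHn -lsumM; last exact: stO.
rewrite -lsumB (lsum_telescope_eq _ (tO_step n)) => [|r].
  by rewrite [q ^+ 0]expr0 subrr !mul0r mulr0 oppr0.
by apply: Oq; have := leq_sq r; lia.
Qed.

Lemma sum_tO' n : lsum (tO' n) = poch 0 n.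
Proof.
apply/eqP; rewrite -sum_tO -subr_eq0 -lsumB (lsum_telescope_eq _ (tO'_tO n)) => [|r].
  by rewrite [q ^+ 0]expr0 subrr mul0r mulr0 !oppr0.
by apply/ON/Oq; have := leq_sq r; lia.
Qed.

(** The two V-sums have the same index d, hence the same q-binomials, so that they
    merge into a sum over r evaluated above. *)
Lemma W_vacuum : W 0 0 - q * W 4 2 = lsum (fun n => q ^+ (2 * n * n) * c (2 * n)).
Proof.
have -> : W 0 0 = V 0 0 := W_V 0 0.
have -> : W 4 2 = V 0 2 := W_V 0 2.
rewrite -lsum2M -?lsum2B; try exact: sV.
apply: eq_lsum => n.
rewrite (@eq_lsum _ (fun r => (q ^+ (2 * n * n) * (c n * c (2 * n))) * tE n r)) => [|r].
  rewrite lsumM; last exact: stE.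
  by rewrite sum_tE -[RHS]mulr1 -(poch_c n); ring.
rewrite addn0 qbin_sym /tE /eV; set P := poch r _; set C := c (2 * n); set D := c n.
by qring.
Qed.

Lemma W_odd1 :
  W 3 1 + q * W 5 2 = lsum (fun n => q ^+ (2 * n * n + 2 * n) * c (2 * n).+1).
Proof.
have -> : W 3 1 = V 1 1 := W_V 1 1.
have -> : W 5 2 = V 1 2 := W_V 1 2.
rewrite -lsum2M -?lsum2D; try exact: sV.
apply: eq_lsum => n.
rewrite (@eq_lsum _ (fun r => (q ^+ (2 * n * n + 2 * n) * (c n * c (2 * n).+1)) * tO n r)) => [|r].
  rewrite lsumM; last exact: stO.
  by rewrite sum_tO -[RHS]mulr1 -(poch_c n); ring.
rewrite addn1 qbin_sym /tO /eV; set P := poch r _; set C := c _.+1; set D := c n.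
by qring.
Qed.

Lemma W_odd0 :
  W 1 0 + q ^+ 3 * W 7 3 = lsum (fun n => q ^+ (2 * n * n + n) * c (2 * n).+1).
Proof.
have -> : W 1 0 = V 1 0 := W_V 1 0.
have -> : W 7 3 = V 1 3 := W_V 1 3.
rewrite -lsum2M -?lsum2D; try exact: sV.
apply: eq_lsum => n.
rewrite (@eq_lsum _ (fun r => (q ^+ (2 * n * n + n) * (c n * c (2 * n).+1)) * tO' n r)) => [|r].
  rewrite lsumM; last exact: stO'.
  by rewrite sum_tO' -[RHS]mulr1 -(poch_c n); ring.
rewrite addn1 qbin_sym /tO' /eV; set P := poch r _; set C := c _.+1; set D := c n.
by qring.
Qed.

(** * Infinite products *)

Lemma O_eqM n f f' g g' : O n (f - f') -> O n (g - g') -> O n (f * g - f' * g').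
Proof.
move=> Of Og; rewrite (_ : _ - _ = (f - f') * g + f' * (g - g')); last by ring.
by apply: OD; [apply: OMr | apply: OMl].
Qed.
Lemma O_eqT n f g h : O n (f - g) -> O n (g - h) -> O n (f - h).
Proof. by move=> Of Og; have := OD Of Og; rewrite addrA subrK. Qed.
Lemma O_eqC n f g : O n (f - g) -> O n (g - f).
Proof. by move=> /ON; rewrite opprB. Qed.
Lemma O_eqE n f g k : O n (f - g) -> (k < n)%N -> f k = g k.
Proof. by move=> Ofg lt_kn; apply/subr0_eq; apply: Ofg. Qed.

(** As for sums: under [near1] the factors of index above k do not affect the
    coefficients of degree at most k. *)
Definition lprod (f : nat -> fps) := Fps (fun k => (\prod_(n < k.+1) f n) k).
Definition near1 (f : nat -> fps) := forall n, O n.+1 (f n - 1).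

Lemma prod_near1 f N M : near1 f -> (N <= M)%N ->
  O N (\prod_(n < M) f n - \prod_(n < N) f n).
Proof.
move=> f1; elim: M => [|M IHM]; first by rewrite leqn0 => /eqP->; rewrite subrr.
rewrite leq_eqVlt => /predU1P[->|]; first by rewrite subrr.
rewrite ltnS => le_NM; rewrite big_ord_recr -[X in _ - X]mulr1 /=.
by apply: O_eqM; [apply: IHM | apply: OW (f1 M); lia].
Qed.

Lemma lprodE f N : near1 f -> O N (lprod f - \prod_(n < N) f n).
Proof.
move=> f1 k lt_kN; rewrite coefB /=; apply/eqP; rewrite subr_eq0 eq_sym.
by apply/eqP; apply: (O_eqE (prod_near1 f1 lt_kN)).
Qed.

Lemma lprod_unique f g : near1 f ->
  (forall N, O N (g - \prod_(n < N) f n)) -> lprod f = g.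
Proof.
move=> f1 Og; apply: O_eq => N.
by apply: O_eqT (lprodE f1) _; apply: O_eqC.
Qed.

Lemma eq_lprod f g : f =1 g -> lprod f = lprod g.
Proof.
by move=> fg; apply: fpsP => k /=; congr (coef _ k); apply: eq_bigr => i _.
Qed.

Lemma near1M f g : near1 f -> near1 g -> near1 (fun n => f n * g n).
Proof. by move=> f1 g1 n; rewrite -[1]mulr1; apply: O_eqM. Qed.

Lemma lprodM f g : near1 f -> near1 g ->
  lprod (fun n => f n * g n) = lprod f * lprod g.
Proof.
move=> f1 g1; apply: lprod_unique => [|N]; first exact: near1M.
by rewrite big_split; apply: O_eqM; apply: lprodE.
Qed.

Lemma lprod1 : lprod (fun=> 1) = 1.
Proof.
apply: lprod_unique => [n|N]; first by rewrite subrr.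
by rewrite big1 // subrr.
Qed.

(** For 0 < a <= m, the integers a, a + m, a + 2m, ... are the positive
    solutions k of this congruence; products along progressions are rewritten
    as products over classes, which combine by union of classes. *)
Definition in_prog a m k := (k == a %[mod m])%N.

Lemma prod_prog a m (g : nat -> fps) N : (0 < a <= m)%N ->
  \prod_(n < m * N) (if in_prog a m n.+1 then g n.+1 else 1)
   = \prod_(n < N) g (a + m * n)%N.
Proof.
case/andP=> a_gt0 le_am; elim: N => [|N IHN]; first by rewrite muln0 !big_ord0.
rewrite big_ord_recr -IHN mulnS addnC big_split_ord /=; congr (_ * _).
have lt_am : (a.-1 < m)%N by lia.
rewrite (bigD1 (Ordinal lt_am)) //= big1 => [|i ne_i].
  rewrite mulr1 (_ : (m * N + a.-1).+1 = a + m * N)%N; last by lia.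
  by rewrite ifT // /in_prog mulnC addnC modnMDl.
rewrite ifF //; apply/negP; rewrite /in_prog => /eqP eq_mod.
case/negP: ne_i; apply/eqP/val_inj => /=.
move: eq_mod; rewrite -addnS mulnC modnMDl.
have := ltn_ord i; case: (ltnP i.+1 m) => [lt_i _|ge_i lt_i].
  rewrite modn_small //; case: (ltnP a m) => [lt_a|ge_a].
    by rewrite modn_small //; lia.
  by rewrite (_ : a = m) ?modnn //; lia.
rewrite (_ : i.+1 = m) ?modnn; last by lia.
case: (ltnP a m) => [lt_a|ge_a]; last by lia.
by rewrite modn_small //; lia.
Qed.

Lemma lprod_prog a m (g : nat -> fps) :
    (0 < a <= m)%N -> (forall k, O k (g k - 1)) ->
  lprod (fun n => g (a + m * n)%N)
   = lprod (fun n => if in_prog a m n.+1 then g n.+1 else 1).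
Proof.
move=> am g1; have m_gt0 : (0 < m)%N by lia.
have near_r : near1 (fun n => if in_prog a m n.+1 then g n.+1 else 1).
  by move=> n; case: ifP => _; [apply: g1 | rewrite subrr].
have near_l : near1 (fun n => g (a + m * n)%N).
  by move=> n; apply: OW (g1 _); nia.
apply: lprod_unique => // N; rewrite -(prod_prog g N am).
by apply: OW (@lprodE _ (m * N) near_r); rewrite leq_pmull.
Qed.

Definition prodm (D : pred nat) := lprod (fun n => if D n.+1 then 1 - q ^+ n.+1 else 1).
Definition prodp (D : pred nat) := lprod (fun n => if D n.+1 then 1 + q ^+ n.+1 else 1).

Lemma near1m (D : pred nat) : near1 (fun n => if D n.+1 then 1 - q ^+ n.+1 else 1).
Proof.
move=> n; case: ifP => _; last by rewrite subrr.
by rewrite addrAC subrr add0r; apply/ON/Oq1.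
Qed.
Lemma near1p (D : pred nat) : near1 (fun n => if D n.+1 then 1 + q ^+ n.+1 else 1).
Proof.
move=> n; case: ifP => _; last by rewrite subrr.
by rewrite addrAC subrr add0r; apply: Oq1.
Qed.

(** The two components of the hypothesis say that F is the union of D and E, and
    that this union is disjoint. *)
Lemma prodmU (D E F : pred nat) :
    (forall k, (0 < k)%N -> (F k = D k || E k) * ~~ (D k && E k)) ->
  prodm F = prodm D * prodm E.
Proof.
move=> FDE; rewrite -lprodM; try exact: near1m.
apply: eq_lprod => n; case: (FDE n.+1) => // ->.
by case: (D _); case: (E _) => //= _; rewrite ?mulr1 ?mul1r.
Qed.
Lemma prodpU (D E F : pred nat) :
    (forall k, (0 < k)%N -> (F k = D k || E k) * ~~ (D k && E k)) ->
  prodp F = prodp D * prodp E.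
Proof.
move=> FDE; rewrite -lprodM; try exact: near1p.
apply: eq_lprod => n; case: (FDE n.+1) => // ->.
by case: (D _); case: (E _) => //= _; rewrite ?mulr1 ?mul1r.
Qed.

(** (1 - q^k)(1 + q^k) = 1 - q^(2k). *)
Lemma prodm_p (D : pred nat) :
  prodm D * prodp D = prodm (fun k => ~~ odd k && D k./2).
Proof.
rewrite -lprodM; [|exact: near1m|exact: near1p].
pose g k : fps := if D k./2 then 1 - q ^+ k else 1.
rewrite (@eq_lprod _ (fun n => g (2 + 2 * n)%N)) => [|n].
  rewrite lprod_prog // => [|k].
    by apply: eq_lprod => n; rewrite /in_prog modnn modn2 eqb0; case: (odd _).
  rewrite /g; case: ifP => _; last by rewrite subrr.
  by rewrite addrAC subrr add0r; apply/ON/Oq1.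
have -> : (2 + 2 * n = n.+1 + n.+1)%N by lia.
rewrite /g addnn doubleK; case: ifP => _; last by rewrite mulr1.
by rewrite -addnn exprD; ring.
Qed.

Lemma lprod_q_prog a m : (0 < a <= m)%N ->
  lprod (fun n => 1 + q ^+ (a + m * n)) = prodp (in_prog a m).
Proof.
move=> am; rewrite (lprod_prog (g := fun k => 1 + q ^+ k)) // => k.
by rewrite addrAC subrr add0r; apply: Oq1.
Qed.

(** * Euler's expansion and the Jacobi triple product *)

(** Determines the binomial coefficient without division, in a form that linear
    arithmetic can use. *)
Lemma bin2_eq n : (2 * 'C(n, 2) + n = n * n)%N.
Proof.
elim: n => // n IHn; rewrite binS bin1; lia.
Qed.

(** Euler's expansion of the product of the 1 + q^(a + mn), n >= 0. *)
Definition euler m a := lsum (fun j => q ^+ (m * 'C(j, 2) + a * j) * ipoch m j).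

Lemma s_euler m a : (0 < a)%N -> summ (fun j => q ^+ (m * 'C(j, 2) + a * j) * ipoch m j).
Proof. by move=> a_gt0; apply: summq => j; nia. Qed.

(** The functional equation that peels off the first factor of the product. *)
Lemma eulerS m a : (0 < m)%N -> (0 < a)%N -> euler m a = (1 + q ^+ a) * euler m (a + m).
Proof.
move=> m_gt0 a_gt0; rewrite mulrDl mul1r; apply/eqP.
rewrite addrC -subr_eq; apply/eqP; rewrite -lsumB lsum_recl.
  rewrite !muln0 addn0 subrr add0r -lsumM; last by apply: s_euler; lia.
  apply: eq_lsum => j.
  rewrite binS bin1 -(ipochS j m_gt0).
  by rewrite !(mulnDl, mulnDr); qring.
by move=> j; apply: OB; apply: s_euler; lia.
Qed.

Lemma euler_near1 m a : (0 < a)%N -> O a (euler m a - 1).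
Proof.
move=> a_gt0; rewrite /euler lsum_recl; last exact: s_euler.
rewrite !muln0 expr0 ipoch0 mulr1 addrAC subrr add0r.
by apply: O_lsum => j; apply: Oq; nia.
Qed.

Lemma euler_prod m a : (0 < m)%N -> (0 < a)%N ->
  euler m a = lprod (fun n => 1 + q ^+ (a + m * n)).
Proof.
move=> m_gt0 a_gt0; symmetry; apply: lprod_unique => [n|N].
  by rewrite addrAC subrr add0r; apply: Oq1; nia.
have -> : euler m a = (\prod_(n < N) (1 + q ^+ (a + m * n))) * euler m (a + m * N).
  elim: N => [|N IHN]; first by rewrite big_ord0 mul1r muln0 addn0.
  rewrite IHN (@eulerS m (a + m * N)) ?addn_gt0 ?a_gt0 // big_ord_recr -mulrA.
  by rewrite mulnS -addnA [(m * N + m)%N]addnC.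
rewrite -[X in O N X](_ : (\prod_(n < N) (1 + q ^+ (a + m * n))) * (euler m (a + m * N) - 1) = _); last by ring.
by apply: OMl; apply: OW (euler_near1 m _); nia.
Qed.

(** Partitions sorted by the size of the largest rectangle of shape j by j + k in
    their diagram: this sum is 1/(x;x)_oo for x = q^m, whatever k is. *)
Definition durfee m k := lsum (fun j => q ^+ (m * (j * j + j * k)) * (ipoch m j * ipoch m (j + k))).
Lemma s_durfee m k : (0 < m)%N ->
  summ (fun j => q ^+ (m * (j * j + j * k)) * (ipoch m j * ipoch m (j + k))).
Proof. by move=> m_gt0; apply: summq => j; have := leq_sq j; nia. Qed.

(** Successive differences are multiples of the next ones, hence divisible by
    every power of q: the sum is independent of k. *)
Lemma durfeeB m k : (0 < m)%N ->
  durfee m k - durfee m k.+1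
    = - (q ^+ (m * k.+1) * (durfee m k.+1 - durfee m k.+2)).
Proof.
move=> m_gt0; pose s := @s_durfee m ^~ m_gt0.
pose X j := q ^+ (m * (j * j + j * k)) * ((1 - q ^+ (m * j)) * (ipoch m j * ipoch m (j + k).+1)).
pose Y j := q ^+ (m * (j * j + j * k + j + k.+1)) * (ipoch m j * ipoch m (j + k).+1).
have sX : summ X by apply: summq => j; have := leq_sq j; nia.
have -> : durfee m k - durfee m k.+1 = lsum X - lsum Y.
  rewrite -!lsumB; apply: eq_lsum => j; rewrite -(ipochS (j + k) m_gt0) /X /Y addnS.
  rewrite (_ : m * (j * j + j * k.+1) = m * j + m * (j * j + j * k))%N; last by lia.
  rewrite (_ : m * (j * j + j * k + j + k.+1) = m * (j + k).+1 + m * (j * j + j * k))%N; last by lia.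
  by rewrite !exprD; ring.
have -> : lsum X = q ^+ (m * k.+1) * durfee m k.+2.
  rewrite lsum_recl // {1}/X muln0 subrr mul0r mulr0 add0r -lsumM //.
  apply: eq_lsum => j; rewrite /X [(1 - _) * _]mulrA ipochS // !addnS.
  rewrite (_ : m * (j.+1 * j.+1 + j.+1 * k) = m * k.+1 + m * (j * j + j * k.+2))%N.
    by rewrite exprD -mulrA.
  by lia.
have -> : lsum Y = q ^+ (m * k.+1) * durfee m k.+1.
  rewrite -lsumM //; apply: eq_lsum => j; rewrite /Y (addnS j k).
  rewrite (_ : m * (j * j + j * k + j + k.+1) = m * k.+1 + m * (j * j + j * k.+1))%N.
    by rewrite exprD -mulrA.
  by lia.
by ring.
Qed.

Lemma durfee_const m k : (0 < m)%N -> durfee m k = durfee m 0.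
Proof.
move=> m_gt0; have OdS n : forall j, O n (durfee m j - durfee m j.+1).
  elim: n => [|n IHn] j; first exact: O0.
  rewrite durfeeB //; apply/ON.
  by apply: OW (OqM (IHn j.+1)); nia.
by elim: k => // k <-; apply: O_eq => n; apply: O_eqC.
Qed.

Definition einf m := lprod (fun n => 1 - q ^+ (m * n.+1)).

Lemma near1_einf m : (0 < m)%N -> near1 (fun n => 1 - q ^+ (m * n.+1)).
Proof. by move=> m_gt0 n; rewrite addrAC subrr add0r; apply/ON/Oq1; nia. Qed.

(** Being independent of k, the sum can be evaluated for k tending to infinity,
    where only the term j = 0 is left. *)
Lemma durfee_einf m k : (0 < m)%N -> durfee m k * einf m = 1.
Proof.
move=> m_gt0; rewrite durfee_const //; apply: O_eq => n.
have pK : ipoch m n * \prod_(i < n) (1 - q ^+ (m * i.+1)) = 1.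
  elim: n => [|n IHn]; first by rewrite ipoch0 big_ord0 mulr1.
  by rewrite -[RHS]IHn -(ipochS n m_gt0) big_ord_recr /=; ring.
rewrite -[X in _ - X]pK; apply: O_eqM; last exact/lprodE/near1_einf.
rewrite -(durfee_const n m_gt0) /durfee lsum_recl; last exact: s_durfee.
rewrite muln0 expr0 ipoch0 !mul1r addrAC subrr add0r.
by apply: O_lsum => j; apply: Oq; nia.
Qed.

Lemma sum_shift (f : nat -> int) N j :
    (j <= N)%N -> (forall i, (N <= i)%N -> f i = 0) ->
  \sum_(i < N | (j <= i)%N) f i = \sum_(k < N) f (j + k)%N.
Proof.
move=> le_jN f0; rewrite -(big_mkord (leq j)) -(big_mkord xpredT (fun k => f (j + k)%N)).
rewrite (@big_cat_nat _ _ _ j) //= big_nat_cond big1 ?add0r => [|i]; last by lia.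
rewrite (@big_cat_nat _ _ _ (N - j) 0) ?leq_subr //= [X in _ + X]big_nat_cond.
rewrite [X in _ + X]big1 ?addr0 => [|i]; last by move=> lt_i; apply: f0; lia.
rewrite -{1}[j]add0n big_addn [in LHS]big_nat_cond [in RHS]big_nat_cond.
by apply: eq_big => [i|i _]; [lia | rewrite addnC].
Qed.

(** Sorting a double sum by the difference of the two indices. *)
Lemma lsum2_diff (T : nat -> nat -> fps) : summ2 T ->
  lsum2 T = lsum2 (fun k j => T (j + k)%N j) + lsum2 (fun k i => T i (i + k.+1)%N).
Proof.
move=> sT; apply: fpsP => n; rewrite coefD /=; set N := n.+1.
have T0 i j : (N <= i)%N || (N <= j)%N -> T i j n = 0.
  by case: (sT i j) => Oi Oj /orP[] ?; [apply: Oi | apply: Oj].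
transitivity (\sum_(i < N) \sum_(j < N | (j <= i)%N) T i j n
    + \sum_(i < N) \sum_(j < N | (i.+1 <= j)%N) T i j n).
  rewrite -big_split; apply: eq_bigr => i _.
  rewrite (bigID (fun j : 'I_N => j <= i)%N) /=; congr (_ + _).
  by apply: eq_bigl => j; rewrite -ltnNge.
congr (_ + _); last first.
  rewrite exchange_big; apply: eq_bigr => i _.
  rewrite (@sum_shift (fun j => T i j n)) //; last by move=> j le_Nj; apply: T0; rewrite le_Nj orbT.
  by apply: eq_bigr => k _; rewrite addSnnS.
rewrite [RHS]exchange_big.
transitivity (\sum_(j < N) \sum_(i < N | (j <= i)%N) T i j n).
  under eq_bigr => i _ do rewrite big_mkcond.
  by rewrite exchange_big; apply: eq_bigr => j _; rewrite -big_mkcond.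
apply: eq_bigr => j _.
rewrite (@sum_shift (fun i => T i j n)) //; first exact: ltnW.
by move=> i le_Ni; apply: T0; rewrite le_Ni.
Qed.

(** The sum over all integers k of q^(m k(k-1)/2 + a k) when a + b = m, the terms
    with k < 0 being those of the second sum. *)
Definition theta m a b :=
  lsum (fun k => q ^+ (m * 'C(k, 2) + a * k))
  + lsum (fun k => q ^+ (m * 'C(k.+1, 2) + b * k.+1)).

Lemma bin2D j k : 'C(j + k, 2) = ('C(j, 2) + 'C(k, 2) + j * k)%N.
Proof.
have := bin2_eq j; have := bin2_eq k; have := bin2_eq (j + k); nia.
Qed.

(** In the product of the two Euler expansions the terms whose indices differ by
    k form the k-th term of the theta series times a Durfee sum. *)
Lemma jacobi a b : (0 < a)%N -> (0 < b)%N ->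
  euler (a + b) a * euler (a + b) b * einf (a + b) = theta (a + b) a b.
Proof.
move=> a_gt0 b_gt0; set m := (a + b)%N; have m_gt0 : (0 < m)%N by rewrite /m; lia.
pose T i j := q ^+ (m * 'C(i, 2) + a * i) * ipoch m i
  * (q ^+ (m * 'C(j, 2) + b * j) * ipoch m j).
have sT : summ2 T.
  by move=> i j; split; [apply: OMr | apply: OMl]; apply: Oq; nia.
have -> : euler m a * euler m b = lsum2 T.
  rewrite /lsum2 mulrC -lsumM; last exact: s_euler.
  apply: eq_lsum => i; rewrite mulrC -lsumM //; exact: s_euler.
rewrite (lsum2_diff sT) mulrDl; congr (_ + _).
  rewrite [lsum2 _](@eq_lsum _ (fun k => q ^+ (m * 'C(k, 2) + a * k) * durfee m k)) => [|k].
    rewrite mulrC -lsumM.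
      by apply: eq_lsum => k; rewrite /= mulrCA [einf m * _]mulrC durfee_einf // mulr1.
    by apply: summq => k; nia.
  rewrite -lsumM; last exact: s_durfee.
  apply: eq_lsum => j; rewrite /T.
  rewrite (_ : _ * _ = q ^+ (m * 'C(j + k, 2) + a * (j + k) + (m * 'C(j, 2) + b * j))
    * (ipoch m j * ipoch m (j + k))); last by rewrite !exprD; ring.
  rewrite [RHS]mulrA -exprD; congr (q ^+ _ * _); rewrite bin2D.
  by have := bin2_eq j; rewrite /m; nia.
rewrite [lsum2 _](@eq_lsum _ (fun k => q ^+ (m * 'C(k.+1, 2) + b * k.+1) * durfee m k.+1)) => [|k].
  rewrite mulrC -lsumM.
    by apply: eq_lsum => k; rewrite /= mulrCA [einf m * _]mulrC durfee_einf // mulr1.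
  by apply: summq => k; nia.
rewrite -lsumM; last exact: s_durfee.
apply: eq_lsum => j; rewrite /T.
rewrite (_ : _ * _ = q ^+ (m * 'C(j, 2) + a * j + (m * 'C(j + k.+1, 2) + b * (j + k.+1)))
    * (ipoch m j * ipoch m (j + k.+1))); last by rewrite !exprD; ring.
rewrite [RHS]mulrA -exprD; congr (q ^+ _ * _); rewrite bin2D.
by have := bin2_eq j; rewrite /m; nia.
Qed.

(** * Dilation and parity *)

Lemma big_ord_pairs (R : nmodType) (h : nat -> R) N :
  \sum_(i < 2 * N) h i = \sum_(n < N) (h (2 * n)%N + h (2 * n).+1).
Proof.
elim: N => [|N IHN]; first by rewrite muln0 !big_ord0.
rewrite (_ : (2 * N.+1 = (2 * N).+2)%N); last by lia.
by rewrite !big_ord_recr /= IHN addrA.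
Qed.

Lemma lsum_pairs F : summ F ->
  lsum F = lsum (fun n => F (2 * n)%N) + lsum (fun n => F (2 * n).+1).
Proof.
move=> sF; apply: fpsP => k; rewrite coefD.
rewrite (@lsumE F (2 * k.+1)) //; last by lia.
by rewrite (big_ord_pairs (fun n => F n k)) big_split.
Qed.

(** The substitution of q^2 for q. *)
Definition dil (f : fps) := Fps (fun k => if odd k then 0 else f k./2).

Lemma dilE f k : dil f k = if odd k then 0 else f k./2. Proof. by []. Qed.
(* Otherwise simplification unfolds the parity test in every coefficient. *)
Opaque dil.

Lemma dil_even f k : dil f (2 * k)%N = f k.
Proof. by rewrite dilE /= mul2n odd_double doubleK. Qed.
Lemma dil_odd f k : dil f (2 * k).+1 = 0.
Proof. by rewrite dilE /= mul2n odd_double. Qed.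

Lemma dilP (f g : fps) : (forall k, g (2 * k)%N = f k) -> (forall k, g (2 * k).+1 = 0) ->
  dil f = g.
Proof.
move=> ge go; apply: fpsP => k; have := odd_double_half k.
by case: (odd k) => <-; rewrite -mul2n ?add0n ?add1n ?dil_even ?dil_odd ?ge ?go.
Qed.

Lemma dilD (f g : fps) : dil (f + g) = dil f + dil g.
Proof. by apply: dilP => k; rewrite coefD ?dil_even // !dil_odd addr0. Qed.
Lemma dilB (f g : fps) : dil (f - g) = dil f - dil g.
Proof. by apply: dilP => k; rewrite coefB ?dil_even // !dil_odd subr0. Qed.
Lemma dilM (f g : fps) : dil (f * g) = dil f * dil g.
Proof.
apply: dilP => k; rewrite coefM.
  rewrite big_ord_recr (big_ord_pairs (fun i => dil f i * dil g (2 * k - i)%N)).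
  rewrite /= big_ord_recr /= dil_even -[in LHS]mulnBr dil_even.
  congr (_ + _); apply: eq_bigr => i _.
  by rewrite dil_odd mul0r addr0 dil_even -mulnBr dil_even.
rewrite big1 // => i _; have := odd_double_half i.
case: (odd i) => eq_i; rewrite -eq_i -mul2n; first by rewrite dil_odd mul0r.
rewrite (_ : (2 * k).+1 - _ = (2 * (k - i./2)).+1)%N ?dil_odd ?mulr0 //.
by have := ltn_ord i; lia.
Qed.
Lemma dil1 : dil 1 = 1.
Proof. by apply: dilP => [[|k]|k]; rewrite ?coef1 //; lia. Qed.
Lemma dil_prod (F : nat -> fps) n : dil (\prod_(i < n) F i) = \prod_(i < n) dil (F i).
Proof.
elim: n => [|n IHn]; first by rewrite !big_ord0 dil1.
by rewrite !big_ord_recr dilM IHn.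
Qed.
Lemma dil_geom k : dil (geom k) = geom (2 * k).
Proof.
apply: dilP => n; rewrite /geom /=; first by rewrite dvdn_pmul2l.
rewrite (_ : 2 * k %| _ = false)%N //; apply/negP => /(dvdn_trans (dvdn_mulr k (dvdnn 2))).
by rewrite dvdn2 /= mul2n odd_double.
Qed.
Lemma dil_ipoch n : dil (ipoch 1 n) = ipoch 2 n.
Proof.
rewrite /ipoch (dil_prod (fun i => geom (1 * i.+1))).
by apply: eq_bigr => i _; rewrite dil_geom mul1n.
Qed.
Lemma dil_q n : dil (q ^+ n) = q ^+ (2 * n).
Proof.
elim: n => [|n IHn]; first by rewrite muln0 dil1.
rewrite exprS dilM IHn mulnS exprD; congr (_ * _).
by apply: dilP => k; rewrite -[q ^+ 2]mulr1 coefqM coef1; case: k => [|[|k]] //=; rewrite ?eqE //=; lia.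
Qed.
Lemma dil_O n f : O n f -> O (2 * n) (dil f).
Proof.
by move=> Of k lt_k; rewrite dilE; case: ifP => // _; apply: Of; lia.
Qed.
Lemma dil_lsum F : summ F -> dil (lsum F) = lsum (fun n => dil (F n)).
Proof.
move=> sF; apply: fpsP => k; rewrite dilE.
case: ifP => odd_k; first by rewrite /= big1 // => i _; rewrite dilE odd_k.
rewrite -[LHS]/(lsum F k./2) (lsumE (N := k.+1) sF); last by lia.
by apply: eq_bigr => i _; rewrite dilE odd_k.
Qed.
Lemma dil_lprod f : near1 f -> dil (lprod f) = lprod (fun n => dil (f n)).
Proof.
move=> f1; symmetry; apply: lprod_unique => [n|N].
  by rewrite -dil1 -dilB; apply: OW (dil_O (f1 n)); lia.
rewrite -dil_prod -dilB; apply: OW (dil_O (lprodE (N := N) f1)); lia.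
Qed.

(** dil f and q * dil g are the even and the odd part of their sum. *)
Lemma parity_inj f g f' g' : dil f + q * dil g = dil f' + q * dil g' -> f = f' /\ g = g'.
Proof.
have qodd (h : fps) k : (q * h) k.+1 = h k by rewrite -[q]expr1 coefqM subn1.
have qe (h : fps) k : (q * dil h) (2 * k)%N = 0.
  case: k => [|k]; first by rewrite -[q]expr1 coefqM.
  by rewrite mulnS qodd dil_odd.
move=> eq_fg; split; apply: fpsP => k.
  by have := congr1 (fun u : fps => u (2 * k)%N) eq_fg; rewrite !coefD !dil_even !qe !addr0.
by have := congr1 (fun u : fps => u (2 * k).+1) eq_fg; rewrite !coefD !dil_odd !qodd !dil_even !add0r.
Qed.

(** * The Ising characters as products *)

Definition ising0 := lsum (fun n => q ^+ (2 * n * n) * c (2 * n)).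
Definition ising1 := lsum (fun n => q ^+ (2 * n * n + 2 * n) * c (2 * n).+1).
Definition ising2 := lsum (fun n => q ^+ (2 * n * n + n) * c (2 * n).+1).

Lemma bin2_even n : 'C(2 * n, 2) = (n * (2 * n) - n)%N.
Proof. by have := bin2_eq (2 * n); nia. Qed.
Lemma bin2_odd n : 'C((2 * n).+1, 2) = (n * (2 * n) + n)%N.
Proof. by have := bin2_eq (2 * n).+1; nia. Qed.

(** The terms 2n and 2n + 1 of Euler's expansion add up, since
    c_(2n) + q^(2n+1) c_(2n+1) = c_(2n+1). *)
Lemma ising2_prod : ising2 = prodp xpredT.
Proof.
transitivity (euler 1 1).
  rewrite /euler lsum_pairs; last exact: s_euler.
  rewrite -lsumD; apply: eq_lsum => n.
  rewrite bin2_even bin2_odd -(cS (2 * n)).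
  rewrite (_ : 1 * _ + 1 * (2 * n) = 2 * n * n + n)%N; last by nia.
  rewrite (_ : 1 * _ + _ = (2 * n).+1 + (2 * n * n + n))%N; last by nia.
  by rewrite [q ^+ ((2 * n).+1 + _)]exprD; ring.
rewrite euler_prod // lprod_q_prog //; apply: eq_lprod => n.
by rewrite /in_prog !modn1.
Qed.

Lemma sIsing0 : summ (fun n => q ^+ (2 * n * n) * c (2 * n)).
Proof. by apply: summq => n; nia. Qed.
Lemma sIsing1 : summ (fun n => q ^+ (2 * n * n + 2 * n) * c (2 * n).+1).
Proof. by apply: summq => n; nia. Qed.

(** The terms of even and of odd index of Euler's expansion are the even and the
    odd part of the series. *)
Lemma ising_dil : dil ising0 + q * dil ising1 = euler 2 1.
Proof.
rewrite /euler lsum_pairs; last exact: s_euler.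
rewrite !dil_lsum; [|exact: sIsing1|exact: sIsing0].
rewrite -lsumM; last first.
  by move=> n; apply: OW (dil_O (@sIsing1 n)); lia.
congr (_ + _); apply: eq_lsum => n; rewrite dilM dil_q dil_ipoch.
  by rewrite bin2_even; congr (q ^+ _ * _); nia.
by rewrite mulrA -exprS bin2_odd; congr (q ^+ _ * _); nia.
Qed.

Lemma s_theta1 m a : (0 < a)%N -> summ (fun k => q ^+ (m * 'C(k, 2) + a * k)).
Proof. by move=> a_gt0 k; apply: Oq1; nia. Qed.
Lemma s_theta2 m a : (0 < a)%N -> summ (fun k => q ^+ (m * 'C(k.+1, 2) + a * k.+1)).
Proof. by move=> a_gt0 k; apply: Oq1; nia. Qed.

(** The exponents k(2k - 1) of this theta series, k in Z, have the parity of k;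
    each of the two halves runs partly through the first and partly through the
    second sum in [theta]. *)
Lemma theta_dil : theta 4 1 3 = dil (theta 8 3 5) + q * dil (theta 8 7 1).
Proof.
have dilth m a b : (0 < a)%N -> (0 < b)%N ->
    dil (theta m a b) = theta (2 * m) (2 * a) (2 * b).
  move=> a_gt0 b_gt0; rewrite dilD !dil_lsum; [|exact: s_theta2|exact: s_theta1].
  by congr (_ + _); apply: eq_lsum => k; rewrite dil_q mulnDr !mulnA.
rewrite !dilth // /theta (lsum_pairs (@s_theta1 4 1 isT)).
rewrite (lsum_pairs (@s_theta2 4 3 isT)).
rewrite [X in _ + X = _]addrC addrACA mulrDr -!lsumM; try by [apply: s_theta1|apply: s_theta2].
congr (_ + _ + (_ + _)); apply: eq_lsum => n; rewrite -?exprS.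
- by rewrite bin2_even; congr (q ^+ _); have := bin2_eq n; nia.
- congr (q ^+ _); rewrite (_ : (2 * n).+2 = 2 * n.+1)%N ?bin2_even; last by lia.
  by have := bin2_eq n.+1; nia.
- by rewrite bin2_odd; congr (q ^+ _); have := bin2_eq n; nia.
- by rewrite bin2_odd; congr (q ^+ _); have := bin2_eq n.+1; nia.
Qed.

(** Infinite products of the 1 - q^k are invertible, hence can be cancelled. *)
Lemma prodm_unit D : exists g, prodm D * g = 1.
Proof.
pose g n := if D n.+1 then geom n.+1 else 1 : fps.
have Og : near1 g.
  move=> n; rewrite /g; case: ifP => _; last by rewrite subrr.
  move=> k lt_k; rewrite coefB coef1 /=.
  by case: k lt_k => [|k] lt_k; rewrite ?dvdn0 // gtnNdvd.
exists (lprod g); rewrite -lprodM //; last exact: near1m.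
rewrite -[RHS]lprod1; apply: eq_lprod => n; rewrite /g.
by case: ifP => _; rewrite ?mulr1 // geomK.
Qed.

Lemma prodm_inj D f g : prodm D * f = prodm D * g -> f = g.
Proof.
have [h hD] := prodm_unit D.
by move=> /(congr1 (fun u => h * u)); rewrite !mulrA [h * _]mulrC hD !mul1r.
Qed.

Lemma euler_prodp m a : (0 < a <= m)%N -> euler m a = prodp (in_prog a m).
Proof. by move=> am; rewrite euler_prod ?lprod_q_prog //; lia. Qed.

Lemma einf_prodm m : (0 < m)%N -> einf m = prodm (in_prog m m).
Proof.
move=> m_gt0; rewrite /prodm -(lprod_prog (g := fun k => 1 - q ^+ k)) => [||k].
- by apply: eq_lprod => n; rewrite mulnS.
- by rewrite m_gt0 leqnn.
by rewrite addrAC subrr add0r; apply/ON/Oq1.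
Qed.

(** Both sides are compared through their combination dil f + q * dil g: on the
    left this is the product of the 1 + q^(2k+1) and of the 1 - q^(4k), on the
    right a theta series. *)
Lemma ising_theta : ising0 * einf 2 = theta 8 3 5 /\ ising1 * einf 2 = theta 8 7 1.
Proof.
apply: parity_inj; rewrite -theta_dil -(@jacobi 1 3) // !dilM mulrA -mulrDl ising_dil.
congr (_ * _).
  rewrite !euler_prodp //; apply: prodpU => k _; rewrite /in_prog.
  by split; lia.
rewrite dil_lprod; last exact: near1_einf.
by apply: eq_lprod => n; rewrite dilB dil1 dil_q mulnA.
Qed.

Definition in_mod (R : seq nat) m k := (k %% m)%N \in R.

(** With S the classes of a and b modulo 8, the triple product gives
    f * prodm(even) = prodp S * prodm(8Z).  Multiplying by prodm S turns prodp S
    into the product over the doubles of S.  The even numbers and S together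
    are D and E, and E consists of the doubles of S and of the multiples of 8,
    so that prodm E cancels. *)
Lemma theta8_cancel (D E : pred nat) (f : fps) a b :
    (0 < a)%N -> (0 < b)%N -> (a + b = 8)%N -> f * einf 2 = theta 8 a b ->
    let S k := in_prog a 8 k || in_prog b 8 k in
    (forall k, ~~ (in_prog a 8 k && in_prog b 8 k)) ->
    (forall k, ~~ (in_prog 2 2 k && S k)) ->
    (forall k, (in_prog 2 2 k || S k = D k || E k) * ~~ (D k && E k)) ->
    (forall k, (E k = (~~ odd k && S k./2) || in_prog 8 8 k)
               * ~~ ((~~ odd k && S k./2) && in_prog 8 8 k)) ->
  f * prodm D = 1.
Proof.
move=> a_gt0 b_gt0 ab8 + S dab dS DE EE; rewrite -ab8 -(@jacobi a b) // !ab8.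
rewrite !euler_prodp; try by lia.
rewrite -(@prodpU _ _ S) => [|k _]; last by split.
rewrite !einf_prodm // => /(congr1 (fun u => prodm S * u)) eq_f.
apply: (@prodm_inj E); rewrite mulr1 [RHS](prodmU (fun k _ => EE k)) -prodm_p.
rewrite -[RHS]mulrA -eq_f mulrCA [RHS]mulrCA; congr (f * _).
rewrite mulrC [RHS]mulrC.
rewrite -(@prodmU D E (fun k => in_prog 2 2 k || S k)) //.
by rewrite -(@prodmU (in_prog 2 2) S (fun k => in_prog 2 2 k || S k)).
Qed.

Lemma ising0_prod : ising0 * prodm (in_mod [:: 2; 3; 4; 5; 11; 12; 13; 14] 16) = 1.
Proof.
have [theta0 _] := ising_theta.
apply: (theta8_cancel (E := in_mod [:: 0; 6; 8; 10] 16)) theta0 _ _ _ _ => // k;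
  rewrite /in_mod /in_prog ?inE; try split; lia.
Qed.

Lemma ising1_prod : ising1 * prodm (in_mod [:: 1; 4; 6; 7; 9; 10; 12; 15] 16) = 1.
Proof.
have [_ theta1] := ising_theta.
apply: (theta8_cancel (E := in_mod [:: 0; 2; 8; 14] 16)) theta1 _ _ _ _ => // k;
  rewrite /in_mod /in_prog ?inE; try split; lia.
Qed.

(** prodp over all k is prodm over the even k divided by prodm over all k. *)
Lemma ising2_prodm : ising2 * prodm odd = 1.
Proof.
rewrite ising2_prod; apply: (@prodm_inj (fun k => ~~ odd k)).
rewrite mulr1 mulrCA mulrC -(@prodmU _ _ xpredT) => [|k _]; last by case: (odd k).
by rewrite prodm_p; apply: eq_lprod => n; rewrite andbT.
Qed.

(** * Generating functions of partitions *)

(** From here on, partitions are written with their parts in increasing order,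
    so that a partition starts with its smallest parts. *)
Definition parts n : seq (seq nat) :=
  [seq rev (map val t) | t : n.-bseq 'I_n.+1 <- enum {: n.-bseq 'I_n.+1}
    & is_partition_of n (map val t)].

Lemma is_partition_rev l : is_partition (rev l) = path leq 1 l.
Proof.
rewrite /is_partition all_rev rev_sorted.
case: l => //= x l; case: posnP => [->|x_gt0]; first by rewrite andbF.
rewrite /=; case: (boolP (path leq x l)) => //=.
rewrite (path_sortedE leq_trans) => /andP[/allP ge_x _]; apply/allP => y /ge_x.
exact: leq_trans.
Qed.

Lemma mem_parts n l : (l \in parts n) = path leq 1 l && (sumn l == n).
Proof.
rewrite -is_partition_rev -sumn_rev -/(is_partition_of n (rev l)); apply/mapP/idP => [[t + ->]|part_l].
  by rewrite mem_filter revK => /andP[].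
have [t [def_t _]] := partition_bseq part_l.
exists t; first by rewrite mem_filter def_t mem_enum part_l.
by rewrite def_t revK.
Qed.

Lemma uniq_parts n : uniq (parts n).
Proof.
rewrite map_inj_uniq => [|t t' /(can_inj revK)/(inj_map val_inj)/val_inj //].
by apply: filter_uniq; apply: enum_uniq.
Qed.

Lemma num_partitionsE n Q :
  num_partitions n Q = count (fun l => `[< Q (rev l) >]) (parts n).
Proof.
rewrite count_map count_filter /num_partitions cardE {1}/enum_mem size_filter -enumT.
apply: eq_count => t.
rewrite /= inE /= revK; apply/asboolP/andP => [[-> /asboolP]|[/asboolP ? ?]] //.
Qed.

Definition gf (P : pred (seq nat)) p : fps :=
  Fps (fun n => (count (fun l => path leq p l && P l) (parts n))%:Z).

Lemma eq_gf P Q p : (forall l, path leq p l -> P l = Q l) -> gf P p = gf Q p.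
Proof.
move=> PQ; apply: fpsP => n; congr (Posz _); apply: eq_count => l.
by case: (boolP (path leq p l)) => //= /PQ.
Qed.

Lemma gf0 (P : pred (seq nat)) p : (forall l, path leq p l -> P l = false) -> gf P p = 0.
Proof.
move=> P0; apply: fpsP => n; rewrite coef0; congr (Posz _).
by apply/eqP; rewrite -leqn0 leqNgt -has_count; apply/hasPn => l _; apply/negP => /andP[/P0->].
Qed.

(** Whether or not p is the smallest part. *)
Lemma gf_rec (P : pred (seq nat)) p : (0 < p)%N ->
  gf P p = gf P p.+1 + q ^+ p * gf (fun l => P (p :: l)) p.
Proof.
move=> p_gt0; apply: fpsP => n; rewrite coefD coefqM.
pose A l := path leq p l && P l; pose B l := head p.+1 l == p.
have -> : gf P p n = (count A (parts n))%:Z by [].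
have -> : gf P p.+1 n = (count (predI A (predC B)) (parts n))%:Z.
  congr (Posz _); apply: eq_count => l; rewrite /A /B /=.
  by case: l => [|x l] /=; lia.
rewrite -size_filter -(count_predC B) !count_filter addnC PoszD.
congr (Posz _ + _); first by apply: eq_count => l; rewrite /= andbC.
have sumn_ge l : (predI B A) l -> (p <= sumn l)%N by case: l => [|x l] /=; rewrite /B /=; lia.
case: ltnP => [lt_np|le_pn].
  congr Posz; apply/eqP; rewrite -leqn0 leqNgt -has_count.
  apply/hasPn => l; rewrite mem_parts => /andP[_ /eqP sum_l].
  by apply/negP => /sumn_ge; rewrite sum_l leqNgt lt_np.
congr Posz; rewrite -!size_filter -[RHS](size_map (cons p)).
apply/perm_size/uniq_perm => [||l].
- by rewrite filter_uniq ?uniq_parts.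
- by rewrite map_inj_uniq ?filter_uniq ?uniq_parts // => l l' [].
rewrite mem_filter mem_parts; apply/idP/mapP => [|[l']].
  case: l => [|x l] /=; rewrite /A /B //=; first by lia.
  case/andP=> /andP[/eqP-> /andP[/andP[_ path_l] Pl]] /andP[path1 sum_l].
  exists l => //; rewrite mem_filter mem_parts path_l Pl /=.
  apply/andP; split; last by lia.
  case/andP: path1 => p1; case: l {Pl sum_l} path_l => //= y l; lia.
rewrite mem_filter mem_parts => /andP[/andP[path_l Pl] /andP[path1 sum_l]] ->.
by rewrite /= /A /B /= eqxx leqnn path_l Pl p_gt0; lia.
Qed.

Lemma gf_near1 (P : pred (seq nat)) p : P [::] -> O p (gf P p - 1).
Proof.
move=> P0 n lt_np; rewrite coefB coef1 /=.
have eq_nil l : l \in parts n -> (path leq p l && P l) = (l == [::]).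
  rewrite mem_parts; case: l => [|x l] //=.
  by case/andP=> _ sum_l; apply/negP => /andP[]; lia.
rewrite (eq_in_count eq_nil) (count_uniq_mem [::] (uniq_parts n)) mem_parts /=.
by case: n {lt_np eq_nil}.
Qed.

(** Admitting the parts of size p divides the series by 1 - q^p if p is in D and
    does not change it otherwise. *)
Lemma gf_all_prodm D : gf (all D) 1 * prodm D = 1.
Proof.
pose g n := if D n.+1 then 1 - q ^+ n.+1 else 1 : fps.
have step p : (0 < p)%N -> gf (all D) p * (if D p then 1 - q ^+ p else 1) = gf (all D) p.+1.
  move=> p_gt0; case: ifP => Dp.
    rewrite mulrBr mulr1 {1}gf_rec //=.
    rewrite (@eq_gf (fun l => D p && all D l) (all D)); first by ring.
    by move=> l _; rewrite Dp.
  rewrite mulr1 gf_rec // [X in _ * X]gf0 ?mulr0 ?addr0 // => l _.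
  by rewrite /= Dp.
have prodE N : gf (all D) 1 * \prod_(n < N) g n = gf (all D) N.+1.
  elim: N => [|N IHN]; first by rewrite big_ord0 mulr1.
  by rewrite big_ord_recr mulrA IHN step.
apply: O_eq => N; apply: (@O_eqT _ _ (gf (all D) 1 * \prod_(n < N) g n)).
  by apply: O_eqM; [rewrite subrr | apply/lprodE/near1m].
by rewrite prodE; apply: OW (@gf_near1 (all D) N.+1 isT).
Qed.

Local Open Scope nat_scope.

(** * Forbidden patterns, read from the smallest part *)

(** The patterns of F other than (5,3,3), reversed: after a part x, the parts
    x + d must not follow in succession.  All of them end in 1, so that every
    x >= 1 occurs; (5,3,3) ends in 3 and only gives a condition for x >= 3. *)
Definition offsets : seq (seq nat) :=
  [:: [:: 0; 0]; [:: 0; 1]; [:: 1; 1]; [:: 1; 2]; [:: 2; 2];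
      [:: 0; 3; 3]; [:: 0; 3; 4]; [:: 1; 3; 4]; [:: 1; 4; 4];
      [:: 0; 2; 4; 5]; [:: 0; 2; 5; 5]; [:: 1; 3; 5; 6]].

(** The pattern coming from (5,3,3) is restricted to x >= t: t = 3 is the
    condition defining the classes, while t = 0 makes the conditions
    translation invariant, as the system of contexts requires. *)
Definition head_ok t x l :=
  ~~ has (fun d => prefix (map (addn x) d) l) offsets
  && ((t <= x) ==> ~~ prefix [:: x; x + 2] l).
Fixpoint avoids t l := if l is x :: l' then head_ok t x l' && avoids t l' else true.

(** The small parts that still matter when the next part to be read is at least
    u + 2.  These nine lists represent all admissible earlier parts up to
    equivalence, two lists being equivalent if they admit the same
    continuations; subtractions do not truncate for u >= ctx_min s. *)
Definition ctx s u : seq nat :=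
  match s with
  | 0 => [::] | 1 => [:: u.+1] | 2 => [:: u.+1; u.+1]
  | 3 => [:: u] | 4 => [:: u; u.+1] | 5 => [:: u; u]
  | 6 => [:: u.-1; u] | 7 => [:: u.-1; u.-1] | _ => [:: u.-2; u.-2; u.+1]
  end.
Definition ctx_min s := match s with 0 | 1 | 2 | 3 | 4 | 5 => 0 | 6 | 7 => 1 | _ => 2 end.
(** The context reached from s by no, one or two copies of u + 2; a missing entry
    means that so many copies are forbidden. *)
Definition ctx_next s : seq nat :=
  match s with
  | 0 => [:: 0; 1; 2] | 1 => [:: 3; 4] | 2 => [:: 5] | 3 => [:: 0; 1]
  | 4 => [:: 6] | 5 => [:: 7] | 6 => [:: 3; 5] | 7 => [:: 0; 8] | _ => [:: 3]
  end.

(** Evaluates Boolean combinations of tests that compare the entries of a list.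
    An equation between entries is decided by arithmetic or split into cases;
    the list is destructed only when a test cannot be evaluated without its
    head, hence as far as the longest relevant pattern reaches. *)
Ltac decide_atom a b :=
  first [ rewrite (_ : (a == b) = true); last by (apply/eqP; lia)
        | rewrite (_ : (a == b) = false); last by (apply/eqP; lia)
        | case: (a =P b) => ? ].
Ltac decide_prefixes :=
  rewrite ?(prefix0s, andbF, orbF, andbT, orbT) /=;
  first [ reflexivity
  | match goal with
    | |- context [?a == ?b] => decide_atom a b; decide_prefixes
    | H : is_true (path leq _ ?l) |- _ =>
        is_var l; let y := fresh "y" in
        destruct l as [|y l]; [clear H | move: H => /= /andP[? H]];  decide_prefixes
    end].

(** The equivalences behind the nine contexts.  The conditions on l alone are
    the same on both sides, so that only the tests that involve the context
    have to be compared. *)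
Lemma avoids_step s m u l : m < 3 -> ctx_min s <= u -> path leq u.+3 l ->
  avoids 0 (ctx s u ++ nseq m u.+2 ++ l)
   = if m < size (ctx_next s) then avoids 0 (ctx (nth 0 (ctx_next s) m) u.+1 ++ l) else false.
Proof.
do 8?[case: s => [|s]]; do 3?[case: m => [|m]]; rewrite // => _.
all: rewrite [ctx_min _]/= [size _]/=; move=> ? H; rewrite [ctx _ _]/= [nseq _ _]/=; try reflexivity.
all: rewrite /= ?[nth _ _ _]/= /head_ok; move: (avoids 0 l) => b.
all: decide_prefixes.
Qed.

Definition in_L (I : seq (seq nat)) l := all (fun d => ~~ prefix (rev d) l) I && avoids 3 l.

Lemma mem_F b :
  (b \in F) = (b == [:: 5; 3; 3]) || (b \in [seq rev (1 :: map succn d) | d <- offsets]).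
Proof.
rewrite -in_cons; have eqF : perm_eq F ([:: 5; 3; 3] :: [seq rev (1 :: map succn d) | d <- offsets]) by [].
exact: perm_mem eqF b.
Qed.

Lemma shift_offset k d : rev (shift k (rev (1 :: map succn d))) = k.+1 :: map (addn k.+1) d.
Proof.
rewrite /shift map_rev revK /= add1n -map_comp; congr (_ :: _).
by apply: eq_map => i /=; rewrite addSnnS addnC.
Qed.

Lemma head_okP x l : 0 < x ->
  (forall b k, b \in F -> ~~ prefix (rev (shift k b)) (x :: l)) <-> head_ok 3 x l.
Proof.
move=> x_gt0; split=> [avF|/andP[/hasPn no_d no_533] b k].
  apply/andP; split; last first.
    apply/implyP => x_ge3; have := avF [:: 5; 3; 3] (x - 3) isT.
    rewrite /shift /rev /= (_ : 3 + (x - 3) = x) ?eqxx; last by lia.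
    by rewrite (_ : 5 + (x - 3) = x + 2); last by lia.
  apply/hasPn => d d_off; have := avF (rev (1 :: map succn d)) x.-1.
  rewrite shift_offset prednK //= eqxx; apply.
  by rewrite mem_F; apply/orP; right; apply/mapP; exists d.
rewrite mem_F => /predU1P[->|/mapP[d d_off ->]].
  rewrite /shift /rev /=; apply/negP => /andP[/eqP eq_x pre].
  move: no_533; rewrite -eq_x leq_addr /= => /negP[].
  by move: pre; rewrite (_ : 3 + k + 2 = 5 + k); last by lia.
by rewrite shift_offset /=; apply/negP => /andP[/eqP->]; apply/negP/no_d.
Qed.

Lemma avoidsP l : path leq 1 l ->
  (forall b k, b \in F -> ~ matches (rev l) (shift k b)) <-> avoids 3 l.
Proof.
elim: l => [|x l IHl] /=.
  split=> // _ b k bF; rewrite /matches /shift.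
  by move: bF; rewrite !inE; do !case/predU1P=> [->//|]; move/eqP->.
case/andP=> x_gt0 path_l.
have eqm b k : matches (rev (x :: l)) (shift k b)
    = prefix (rev (shift k b)) (x :: l) || matches (rev l) (shift k b).
  by rewrite /matches -!(infix_rev (shift k b)) !revK.
have path1 : path leq 1 l by case: l path_l {IHl eqm} => //= y l /andP[? ->]; lia.
split=> [avF|/andP[ok_x av_l] b k bF].
  apply/andP; split.
    apply/head_okP => // b k bF; apply/negP => pre; case: (avF b k bF).
    by rewrite eqm pre.
  by apply/IHl => // b k bF mat; case: (avF b k bF); rewrite eqm mat orbT.
rewrite eqm => /orP[pre|]; last by move: bF; apply: (IHl path1).2.
by have := (head_okP l x_gt0).2 ok_x b k bF; rewrite pre.
Qed.

Lemma L_in_L I l : path leq 1 l -> `[< L I (rev l) >] = in_L I l.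
Proof.
move=> path_l; have path_rev := path_l; rewrite -is_partition_rev in path_rev.
apply/asboolP/andP => [[_ begI matF]|[/allP begI av_l]].
  split; last by apply/avoidsP.
  apply/allP => d dI; apply/negP => pre; case: (begI d dI).
  by rewrite /begins_with -prefix_rev revK.
split=> //; last by apply/avoidsP.
move=> d dI; rewrite /begins_with -prefix_rev revK => pre.
by have := begI d dI; rewrite pre.
Qed.

(** * The first parts *)

Lemma avoids3E l : path leq 3 l -> avoids 3 l = avoids 0 l.
Proof.
have avoids3E_ x : (2 < x)%N -> path leq x l -> avoids 3 l = avoids 0 l.
  elim: l x => //= y l IHl x x_ge3 /andP[le_xy path_l].
  have y_ge3 : (2 < y)%N by lia.
  by rewrite (IHl y) // /head_ok y_ge3.
exact: avoids3E_.
Qed.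

Lemma avoids3E2 l : path leq 2 l -> ~~ prefix [:: 2; 2] l -> avoids 3 l = avoids 0 l.
Proof.
case: l => [|x [|y l]] // path_l; first by rewrite /= /head_ok /= !implybT.
have [x_ge3 _|x_lt3 no22] := leqP 3 x.
  by apply: avoids3E; move: path_l => /= /andP[_ path_x]; rewrite x_ge3.
have [x2 y_ge3] : x = 2%N /\ (3 <= y)%N.
  move: path_l => /= /and3P[x_ge2 le_xy _]; have x2 : x = 2%N by lia.
  by split=> //; move: no22 le_xy; rewrite x2 /= prefix0s andbT; case: eqP; lia.
rewrite [LHS]/= -[head_ok 3 y l && _]/(avoids 3 (y :: l)) avoids3E.
  rewrite x2 [RHS]/=; by congr (_ && _); rewrite /head_ok /= ?(ltn_eqF y_ge3).
by move: path_l => /= /and3P[_ _ ?]; rewrite y_ge3.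
Qed.

(** After the parts 1, 2 (and 4), each class behaves like one of the contexts:
    the excluded beginnings I_a have the effect of fictitious smaller parts. *)
Lemma L1_init0 l : path leq 3 l -> in_L I1 l = avoids 0 l.
Proof. by move=> H; rewrite /in_L avoids3E // /=; move: (avoids 0 l) => b; decide_prefixes. Qed.
Lemma L1_init1 l : path leq 3 l -> in_L I1 (2 :: l) = avoids 0 (ctx 1 1 ++ l).
Proof.
by move=> H; rewrite /in_L /= avoids3E // /head_ok; move: (avoids 0 l) => b; decide_prefixes.
Qed.
Lemma path_leqW m n l : m <= n -> path leq n l -> path leq m l.
Proof. by case: l => //= x l; lia. Qed.

Lemma L1_init2 l : path leq 5 l -> in_L I1 (2 :: 2 :: l) = avoids 0 (ctx 7 3 ++ l).
Proof.
move=> H; rewrite /in_L /= avoids3E /head_ok; first by move: (avoids 0 l) => b; decide_prefixes.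
exact: path_leqW H.
Qed.
Lemma L1_init3 l : path leq 5 l -> in_L I1 (2 :: 2 :: 4 :: l) = avoids 0 (ctx 4 3 ++ l).
Proof.
move=> H; rewrite /in_L /= avoids3E /head_ok; first by move: (avoids 0 l) => b; decide_prefixes.
exact: path_leqW H.
Qed.

Lemma L2_init0 l : path leq 2 l -> in_L I2 l = avoids 0 (ctx 3 0 ++ l).
Proof.
move=> H; rewrite /in_L; case: (boolP (prefix [:: 2; 2] l)) => [/prefixP[l' ->]|no22].
  by rewrite /= /head_ok /= ?(prefix0s, orbT, andbF).
rewrite (avoids3E2 H no22); move: no22; rewrite /= /head_ok.
by move: (avoids 0 l) => b; decide_prefixes.
Qed.
Lemma L2_init1 l : path leq 3 l -> in_L I2 (1 :: l) = avoids 0 (ctx 7 1 ++ l).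
Proof.
by move=> H; rewrite /in_L /= avoids3E // /head_ok; move: (avoids 0 l) => b; decide_prefixes.
Qed.
Lemma L2_init2 l : path leq 3 l -> in_L I2 (1 :: 2 :: l) = avoids 0 (ctx 4 1 ++ l).
Proof.
by move=> H; rewrite /in_L /= avoids3E // /head_ok; move: (avoids 0 l) => b; decide_prefixes.
Qed.

Lemma L3_init0 l : path leq 3 l -> in_L I3 l = avoids 0 (ctx 3 1 ++ l).
Proof.
by move=> H; rewrite /in_L /= avoids3E // /head_ok; move: (avoids 0 l) => b; decide_prefixes.
Qed.
Lemma L3_init1 l : path leq 3 l -> in_L I3 (2 :: l) = avoids 0 (ctx 5 1 ++ l).
Proof.
by move=> H; rewrite /in_L /= avoids3E // /head_ok; move: (avoids 0 l) => b; decide_prefixes.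
Qed.
Lemma L3_init2 l : path leq 2 l -> in_L I3 (1 :: l) = avoids 0 (ctx 4 0 ++ l).
Proof.
move=> H; rewrite /in_L; case: (boolP (prefix [:: 2; 2] l)) => [/prefixP[l' ->]|no22].
  by rewrite /= /head_ok /= ?(prefix0s, orbT, andbF).
rewrite /= (avoids3E2 H no22); move: no22; rewrite /= /head_ok.
by move: (avoids 0 l) => b; decide_prefixes.
Qed.

Local Open Scope ring_scope.

(** * Solving the system of contexts *)

(** Sorting by the multiplicity of p, which is less than M. *)
Lemma gf_mult (P : pred (seq nat)) p M : (0 < p)%N ->
    (forall l, path leq p l -> P (nseq M p ++ l) = false) ->
  gf P p = \sum_(m < M) q ^+ (m * p) * gf (fun l => P (nseq m p ++ l)) p.+1.
Proof.
move=> p_gt0; elim: M P => [|M IHM] P PM; first by rewrite big_ord0; apply: gf0.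
rewrite gf_rec // big_ord_recl mul1r; congr (_ + _).
rewrite IHM => [|l path_l]; last by apply: (PM l).
rewrite mulr_sumr; apply: eq_bigr => m _.
by rewrite mulrA -exprD.
Qed.

Definition gf_ctx s u := gf (fun l => avoids 0 (ctx s u ++ l)) u.+2.

(** The solution of the system, with u measuring the position. *)
Definition W_ctx s u : fps :=
  match s with
  | 0 => W (2 * u)%N (u + 1)%N
  | 1 => W (2 * u + 3)%N (u + 2)%N + q ^+ u.+2 * W (2 * u + 7)%N (u + 3)%N
  | 2 => W (2 * u + 6)%N (u + 3)%N
  | 3 => W (2 * u + 1)%N (u + 1)%N
  | 4 => W (2 * u + 5)%N (u + 2)%N
  | 5 => W (2 * u + 4)%N (u + 2)%N
  | 6 => W (2 * u + 3)%N (u + 1)%N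
  | 7 => W (2 * u + 2)%N (u + 1)%N
  | _ => W (2 * u + 3)%N (u + 2)%N
  end.

Definition ctx_rec (X : nat -> nat -> fps) := forall s u, (ctx_min s <= u)%N ->
  X s u = \sum_(m < 3 | (m < size (ctx_next s))%N)
            q ^+ (m * u.+2) * X (nth 0 (ctx_next s) m) u.+1.

Lemma avoids_cat t l1 l2 : avoids t (l1 ++ l2) -> avoids t l2.
Proof. by elim: l1 => //= x l1 IHl /andP[_ /IHl]. Qed.

Lemma gf_ctx_rec : ctx_rec gf_ctx.
Proof.
move=> s u le_u; rewrite /gf_ctx (@gf_mult _ _ 3) // => [|l _]; last first.
  by apply/negP => /avoids_cat; rewrite /= /head_ok /= addn0 !eqxx prefix0s.
rewrite [RHS]big_mkcond; apply: eq_bigr => m _.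
case: ifP => lt_m.
  by congr (_ * _); apply: eq_gf => l path_l; rewrite avoids_step // lt_m.
by rewrite gf0 ?mulr0 // => l path_l; rewrite avoids_step // lt_m.
Qed.

Lemma W_recl_at a b a1 a2 b2 e : a1 = a.+1 -> a2 = (a + 8)%N -> b2 = (b + 3)%N ->
  e = (a + 4)%N -> W a b = W a1 b + q ^+ e * W a2 b2.
Proof. by move=> -> -> -> ->; apply: W_recl. Qed.
Lemma W_recr_at a b b1 a2 b2 : b1 = b.+1 -> a2 = (a + 3)%N -> b2 = (b + 2)%N ->
  W a b = W a b1 + q ^+ b1 * W a2 b2.
Proof. by move=> -> -> ->; apply: W_recr. Qed.

(** Contexts 0 and 3 need several steps of the recurrences, collected in W3; the
    other equations hold by definition or are instances of [W_recr]. *)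
Lemma W_ctx_rec : ctx_rec W_ctx.
Proof.
have sum3 (P : pred nat) (f : nat -> fps) : \sum_(m < 3 | P m) f m =
    (if P 0 then f 0%N else 0) + (if P 1 then f 1%N else 0) + (if P 2%N then f 2%N else 0).
  by rewrite big_mkcond !big_ord_recl big_ord0 /= addr0 addrA.
move=> s u _; rewrite (sum3 (fun m => m < size (ctx_next s))%N
  (fun m => q ^+ (m * u.+2) * W_ctx (nth 0 (ctx_next s) m) u.+1)).
have W3 : W (2 * u + 1) (u + 1) = W_ctx 0 u.+1 + q ^+ u.+2 * W_ctx 1 u.+1.
  rewrite /W_ctx (@W_recr_at _ (u + 1) (u + 2) (2 * u + 4) (u + 3)); try lia.
  rewrite (@W_recl_at _ (u + 2) (2 * u + 2) (2 * u + 9) (u + 5) (2 * u + 5)); try lia.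
  rewrite (@W_recl_at _ (u + 3) (2 * u + 5) (2 * u + 12) (u + 6) (2 * u + 8)); try lia.
  rewrite (@W_recr_at (2 * u.+1 + 7) (u.+1 + 3) (u + 5) (2 * u + 12) (u + 6)); try lia.
  rewrite (_ : 2 * u.+1 = 2 * u + 2)%N; last by lia.
  rewrite -!addnA !addSnnS !add0n !addnA.
  qring.
case: s => [|[|[|[|[|[|[|[|s]]]]]]]] //=;
  rewrite ?mul0n ?mul1n ?expr0 ?mul1r ?addr0.
- rewrite (@W_recl_at (2 * u) (u + 1) (2 * u + 1) (2 * u + 8) (u + 4) (2 * u + 4)); try lia.
  by rewrite W3; congr (_ + q ^+ _ * W _ _); lia.
- by congr (W _ _ + q ^+ _ * W _ _); lia.
- by congr (W _ _); lia.
- by rewrite W3.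
- by congr (W _ _); lia.
- by congr (W _ _); lia.
- rewrite (@W_recr_at _ (u + 1) (u + 2) (2 * u + 6) (u + 3)); try lia.
  by congr (W _ _ + q ^+ _ * W _ _); lia.
- rewrite (@W_recr_at _ (u + 1) (u + 2) (2 * u + 5) (u + 3)); try lia.
  by congr (W _ _ + q ^+ _ * W _ _); lia.
- by congr (W _ _); lia.
Qed.

Lemma W_near1 a b n : (n <= a)%N -> (n <= b)%N -> O n (W a b - 1).
Proof.
move=> le_na le_nb; rewrite /W (lsum2_recl (sW a b)) lsum_recl; last exact: summ2_row (sW a b) 0%N.
have -> : eW a b 0 0 = 0%N by rewrite /eW; lia.
rewrite ipoch0 !mul1r addrAC [1 + _]addrC addrK.
apply: OD; first by apply: O_lsum => j; apply: Oq; rewrite /eW; nia.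
by apply: O_lsum => i; apply: O_lsum => j; apply: Oq; rewrite /eW; nia.
Qed.

Lemma W_ctx_near1 s u : O u (W_ctx s u - 1).
Proof.
have Wn a b : (u <= a)%N -> (u <= b)%N -> O u (W a b - 1) by apply: W_near1.
case: s => [|[|[|[|[|[|[|[|s]]]]]]]] /=; try by apply: Wn; lia.
rewrite addrAC; apply: OD; first by apply: Wn; lia.
by apply: Oq; lia.
Qed.

Lemma avoids_ctx s u : (ctx_min s <= u)%N -> avoids 0 (ctx s u).
Proof.
change ((ctx_min s <= u)%N -> avoids 0 (ctx s u) = true).
by case: s => [|[|[|[|[|[|[|[|s]]]]]]]] /= le_u; rewrite /head_ok; decide_prefixes.
Qed.

Lemma gf_ctx_near1 s u : (ctx_min s <= u)%N -> O u (gf_ctx s u - 1).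
Proof.
move=> le_u; apply: OW (gf_near1 _); first by lia.
by rewrite cats0 avoids_ctx.
Qed.

(** The system determines X at position u by its values at u + 1, and X is known
    modulo q^u: starting from ever larger positions determines X completely. *)
Lemma ctx_rec_unique X Y : ctx_rec X -> ctx_rec Y ->
    (forall s u, (ctx_min s <= u)%N -> O u (X s u - 1)) ->
    (forall s u, (ctx_min s <= u)%N -> O u (Y s u - 1)) ->
  forall s u, (ctx_min s <= u)%N -> X s u = Y s u.
Proof.
move=> recX recY X1 Y1.
have min_next s m u : (m < size (ctx_next s))%N -> (ctx_min s <= u)%N ->
    (ctx_min (nth 0 (ctx_next s) m) <= u.+1)%N.
  by case: s m => [|[|[|[|[|[|[|[|s]]]]]]]] [|[|[|m]]] //= _; lia.
suff OXY n s u : (ctx_min s <= u)%N -> O (n + u) (X s u - Y s u).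
  by move=> s u le_u; apply: O_eq => n; apply: OW (OXY n s u _); lia.
elim: n s u => [|n IHn] s u le_u.
  by apply: (@O_eqT _ _ 1); [apply: X1 | apply/O_eqC/Y1].
rewrite recX // recY // -sumrB; apply: O_sum => m lt_m; rewrite -mulrBr addSnnS.
by apply/OMl/IHn; apply: min_next.
Qed.

Lemma gf_ctxE s u : (ctx_min s <= u)%N -> gf_ctx s u = W_ctx s u.
Proof.
apply: ctx_rec_unique => [||s' u' le_u|s' u' _].
- exact: gf_ctx_rec.
- exact: W_ctx_rec.
- exact: gf_ctx_near1.
- exact: W_ctx_near1.
Qed.

(** * The three generating functions *)

Ltac forbidden :=
  let l := fresh "l" in let H := fresh "H" in
  move=> l H; rewrite /in_L /= /head_ok; move: (avoids 3 l) => ?;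
  decide_prefixes.

Lemma gf_L1 : gf (in_L I1) 1 = ising0.
Proof.
rewrite (@gf_mult _ 1 1) //; last by forbidden.
rewrite big_ord1 mul1r (@gf_mult _ 2 3) //; last by forbidden.
rewrite !big_ord_recl big_ord0 /=.
(* After two parts 2, no part 3 and at most one part 4 can follow. *)
rewrite (@gf_mult (fun l => in_L I1 (2 :: 2 :: l)%N) 3 1) //; last by forbidden.
rewrite big_ord1 /= (@gf_mult _ 4 2) //; last by forbidden.
rewrite !big_ord_recl big_ord0 /=.
rewrite (eq_gf L1_init0) (eq_gf L1_init1) (eq_gf L1_init2) (eq_gf L1_init3).
rewrite -/(gf_ctx 0 1) -/(gf_ctx 1 1) -/(gf_ctx 7 3) -/(gf_ctx 4 3) !gf_ctxE // /W_ctx.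
(* The sums over the multiplicities, with all indices computed. *)
rewrite -[LHS]/(q ^+ 0 * W 2 2 + (q ^+ 2 * (W 5 3 + q ^+ 3 * W 9 4)
  + (q ^+ 4 * (q ^+ 0 * (q ^+ 0 * W 8 4 + (q ^+ 4 * W 11 5 + 0))) + 0))).
rewrite -[RHS]W_vacuum (@W_recr_at 0 0 1 3 2) // (@W_recl_at 3 2 4 11 5 7) //.
rewrite (@W_recl_at 0 1 1 8 4 4) // (@W_recr_at 1 1 2 4 3) //.
rewrite (@W_recl_at 1 2 2 9 5 5) // (@W_recl_at 4 3 5 12 6 8) //.
by rewrite (@W_recr_at 9 4 5 12 6) //; ring.
Qed.

Lemma gf_L2 : gf (in_L I2) 1 = ising2.
Proof.
rewrite (@gf_mult _ 1 2) //; last by forbidden.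
rewrite !big_ord_recl big_ord0 /= (eq_gf L2_init0).
rewrite (@gf_mult (fun l => in_L I2 (1 :: l)%N) 2 2) //; last by forbidden.
rewrite !big_ord_recl big_ord0 /= (eq_gf L2_init1) (eq_gf L2_init2).
rewrite -/(gf_ctx 3 0) -/(gf_ctx 7 1) -/(gf_ctx 4 1) !gf_ctxE // /W_ctx.
rewrite -[LHS]/(q ^+ 0 * W 1 1
  + (q ^+ 1 * (q ^+ 0 * W 4 2 + (q ^+ 2 * W 7 3 + 0)) + 0)).
by rewrite -[RHS]W_odd0 (@W_recr_at 1 0 1 4 2) //; ring.
Qed.

Lemma gf_L3 : gf (in_L I3) 1 = ising1.
Proof.
rewrite (@gf_mult _ 1 2) //; last by forbidden.
rewrite !big_ord_recl big_ord0 /= (eq_gf L3_init2).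
rewrite (@gf_mult (in_L I3) 2 2) //; last by forbidden.
rewrite !big_ord_recl big_ord0 /= (eq_gf L3_init0) (eq_gf L3_init1).
rewrite -/(gf_ctx 4 0) -/(gf_ctx 3 1) -/(gf_ctx 5 1) !gf_ctxE // /W_ctx.
rewrite -[LHS]/(q ^+ 0 * (q ^+ 0 * W 3 2 + (q ^+ 2 * W 6 3 + 0))
  + (q ^+ 1 * W 5 2 + 0)).
by rewrite -[RHS]W_odd1 (@W_recr_at 3 1 2 6 3) //; ring.
Qed.

(** * Comparing coefficients *)

Lemma num_L n I : num_partitions n (L I) = gf (in_L I) 1 n :> int.
Proof.
rewrite num_partitionsE; congr Posz; apply: eq_in_count => l.
by rewrite mem_parts => /andP[path_l _]; rewrite path_l L_in_L.
Qed.

Lemma num_class n (D : pred nat) Q : (forall s, Q s <-> all D s) ->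
  num_partitions n Q = gf (all D) 1 n :> int.
Proof.
move=> QD; rewrite num_partitionsE; congr Posz; apply: eq_in_count => l.
rewrite mem_parts => /andP[-> _] /=; rewrite -all_rev.
by apply/asboolP/idP => /QD.
Qed.

Lemma num_L_class I D Q f n : gf (in_L I) 1 = f -> f * prodm D = 1 ->
  (forall s, Q s <-> all D s) -> num_partitions n (L I) = num_partitions n Q.
Proof.
move=> gfL fD QD; apply/eqP; rewrite -eqz_nat num_L (num_class n QD) gfL.
apply/eqP; congr (coef _ n); apply: (@prodm_inj D).
by rewrite mulrC fD mulrC gf_all_prodm.
Qed.

Local Open Scope nat_scope.
Theorem theorem1p5 (n : nat) :
  [/\ num_partitions n (L I1)
      = num_partitions n (parts_mod16 [:: 2; 3; 4; 5; 11; 12; 13; 14]),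
      num_partitions n (L I2)
      = num_partitions n (fun s => forall x, x \in s -> odd x)
    & num_partitions n (L I3)
      = num_partitions n (parts_mod16 [:: 1; 4; 6; 7; 9; 10; 12; 15])].
Proof.
split.
- by apply: num_L_class gf_L1 ising0_prod _ => s; split=> /allP.
- by apply: num_L_class gf_L2 ising2_prodm _ => s; split=> /allP.
- by apply: num_L_class gf_L3 ising1_prod _ => s; split=> /allP.
Qed.
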